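(* For any integer $c\ge 2$ and any complex $s$ with $\operatorname{Re}(s)>-1$, $$e^{\zeta_{(c)}'(s)}=\left(\prod_{i=2}^{c-1}i^{-\frac{c+i-1}{c\,i^s}}\right)\cdot c^{\frac{(c-1)^2}{c^{s+1}}}\cdot\lim_{N\to\infty}\prod_{n=1}^{cN}\prod_{i=1}^{c}(n+i)^{\frac{a_{c,n}a_{c,i}}{c(n+i)^s}},$$ where the first product is defined to be $1$ for $c=2$.
   Context: $\zeta_{(c)}(s)=(1-c^{1-s})\zeta(s)$, where $\zeta$ is the (meromorphically continued) Riemann zeta function; $\zeta_{(c)}$ is an entire function (the singularity at $s=1$ is removable) and $\zeta_{(c)}'$ is its derivative. For integers $n\ge1$, $a_{c,n}=1-c$ if $n\equiv 0\pmod c$ and $a_{c,n}=1$ otherwise. For a positive integer $n$ and complex $w$, $n^w=e^{w\log n}$ with the real logarithm. *)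

(* Defs.v *)
From Stdlib Require Import Reals.
From Coquelicot Require Import Coquelicot.

Local Open Scope C_scope.

Definition Cexp (z : C) : C := exp (Re z) * (cos (Im z), sin (Im z)).

(* n^w = e^(w log n) for an integer n >= 1; only ever used with n >= 1. *)
Definition npow (n : nat) (w : C) : C := Cexp (w * RtoC (ln (INR n))).

(* The product of f i over m <= i <= n; it is 1 when n < m. *)
Definition Cprod (m n : nat) (f : nat -> C) : C := Iter.iter_nat Cmult 1 f m n.

(* zeta is holomorphic on C \ {1} and equal to the Dirichlet series on Re s > 1.
   By the identity theorem this determines zeta on C \ {1}; its value at the
   pole s = 1 is left arbitrary. *)
Definition is_riemann_zeta (zeta : C -> C) : Prop :=
  (forall s : C, s <> 1 -> ex_derive zeta s) /\
  (forall s : C, (1 < Re s)%R ->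
     is_series (fun n : nat => 1 / npow (S n) s) (zeta s)).

(* zc is the entire function s |-> (1 - c^(1-s)) zeta(s), whose value at the
   removable singularity s = 1 is determined by continuity. *)
Definition is_zeta_c (zeta : C -> C) (c : nat) (zc : C -> C) : Prop :=
  (forall s : C, ex_derive zc s) /\
  (forall s : C, s <> 1 -> zc s = (1 - npow c (1 - s)) * zeta s).

Definition a (c n : nat) : C :=
  if Nat.eqb (n mod c) 0 then 1 - RtoC (INR c) else 1.

(* Main.v *)
Require Import Defs.
From Stdlib Require Import Reals Lra Lia Psatz ClassicalEpsilon Classical.
From Coquelicot Require Import Coquelicot.

(** Write f(m) = m^(-s) and let A_N(f) be the sum of a_n a_i f(n+i) over
    1 <= n <= cN and 1 <= i <= c.

    The weights a are periodic with sum 0 over a period, so one block of A_N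
    (c consecutive values of n) annihilates affine functions.  It is therefore
    bounded by the second derivative of x^(-s), that is by a multiple of
    k^(-Re s - 2) for the k-th block, and A_N(f) converges for Re s > -1
    ([blocks_converge]).  The second-order Taylor remainder of m^(-s) in s obeys
    the same kind of bound with an extra factor h^2, so the limit is
    holomorphic there and may be differentiated term by term
    ([is_derive_regularized_sum]).

    For Re s > 1 the Dirichlet series of zeta converges.  Writing the
    weights as 1 - c [c | n] expresses A_N(f) by partial sums of that series
    ([double_sum_closed_form]), and in the limit
    c * zeta_c(s) = boundary_terms - lim A_N(f), where the boundary terms are
    a combination of the finitely many f(m) with m <= c, for which A_N(f) lacks
    some of the pairs n + i = m of a full period ([regularized_sum_eq_half_plane]).

    Both sides are holomorphic on Re s > -1, hence they agree there
    ([half_plane_unique_continuation]).  Differentiating at s and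
    exponentiating gives the formula.

    Unique continuation is derived from Goursat's theorem on rectangles
    ([goursat]) without power series.  If h vanishes on Re z > b, integrate
    h(z) exp(L (z - z0)^2) around a rectangle whose left side is centred at z0
    and whose right side lies in the zero region.  On the left side the weight
    is the Gaussian exp(-L y^2), which concentrates at z0; on horizontal sides
    at a distance larger than the width of the rectangle it is at most
    exp(-L).  As L tends to infinity this forces h(z0) = 0. *)

(** * Derivatives over C and over R, and the complex exponential *)

Local Open Scope C_scope.

Lemma is_derive_C_iff (f : C -> C) (z l : C) :
  is_derive f z l <->
  forall eps : R, (0 < eps)%R -> exists delta : R, (0 < delta)%R /\
    forall w : C, (Cmod (w - z) < delta)%R ->
      (Cmod (f w - f z - (w - z) * l) <= eps * Cmod (w - z))%R.
Proof.
  split.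
  - intros [_ H] eps Heps.
    destruct (H z (fun P HP => HP) (mkposreal _ Heps)) as [d Hd].
    exists d; split; [apply cond_pos |].
    intros w Hw. exact (Hd w Hw).
  - intros H. split; [apply is_linear_scal_l |].
    intros x Hx eps.
    assert (x = z) as ->.
    { symmetry. exact (is_filter_lim_locally_unique (V := AbsRing_NormedModule C_AbsRing) z x Hx). }
    destruct (H eps (cond_pos eps)) as [d [Hd H']].
    exists (mkposreal d Hd). intros w Hw. exact (H' w Hw).
Qed.

Lemma exp_le (x y : R) : (x <= y)%R -> (exp x <= exp y)%R.
Proof. intros [H | ->]; [left; now apply exp_increasing | right; reflexivity]. Qed.

(** Componentwise, so that the real calculus (mean value theorem, [auto_derive])
    applies directly. *)
Definition is_derive_RC (f : R -> C) (x : R) (l : C) : Prop :=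
  is_derive (fun t : R => Re (f t)) x (Re l) /\
  is_derive (fun t : R => Im (f t)) x (Im l).

Lemma Cmod_sqr (z : C) : (Cmod z * Cmod z = Re z * Re z + Im z * Im z)%R.
Proof. pose proof (Cmod2_alt z) as H. simpl in H. lra. Qed.

Lemma im_le_Cmod (z : C) : (Rabs (Im z) <= Cmod z)%R.
Proof.
  eapply Rle_trans; [| apply Rmax_Cmod]. apply Rmax_r.
Qed.

(** The mean value theorem fails for complex-valued functions; it is applied to the
    real function t |-> Re (conj u * f t), where u = f y - f x. *)
Lemma is_derive_RC_mvt (f df : R -> C) (x y M : R) :
  (x <= y)%R ->
  (forall t, (x <= t <= y)%R -> is_derive_RC f t (df t)) ->
  (forall t, (x <= t <= y)%R -> (Cmod (df t) <= M)%R) ->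
  (Cmod (f y - f x) <= M * (y - x))%R.
Proof.
  intros Hxy Hd HM.
  set (u := f y - f x).
  destruct (Req_dec (Cmod u) 0) as [Hu | Hu].
  { rewrite Hu. assert (0 <= Cmod (df x))%R by apply Cmod_ge_0.
    specialize (HM x ltac:(lra)). nra. }
  pose proof (Cmod_ge_0 u) as Hu0.
  set (psi := fun t : R => (Re u * Re (f t) + Im u * Im (f t))%R).
  destruct (MVT_gen psi x y (fun t => (Re u * Re (df t) + Im u * Im (df t))%R))
    as [t [Ht He]].
  - rewrite Rmin_left, Rmax_right by lra. intros t Ht. destruct (Hd t ltac:(lra)) as [H1 H2].
    apply @is_derive_plus; apply is_derive_scal; assumption.
  - rewrite Rmin_left, Rmax_right by lra. intros t Ht. destruct (Hd t ltac:(lra)) as [H1 H2].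
    apply continuity_pt_filterlim. apply @ex_derive_continuous.
    eexists. apply @is_derive_plus; apply is_derive_scal; eassumption.
  - rewrite Rmin_left, Rmax_right in Ht by lra.
    assert (E : (psi y - psi x = Cmod u * Cmod u)%R).
    { rewrite Cmod_sqr. unfold psi, u, Cminus. rewrite !re_plus, !im_plus, !re_opp, !im_opp. ring. }
    rewrite E in He.
    assert (Hb : (Re u * Re (df t) + Im u * Im (df t) <= Cmod u * Cmod (df t))%R).
    { replace (Re u * Re (df t) + Im u * Im (df t))%R with (Re (Cconj u * df t)).
      - eapply Rle_trans; [apply Rle_abs |]. eapply Rle_trans; [apply re_le_Cmod |].
        rewrite Cmod_mult, Cmod_conj. lra.
      - rewrite re_mult, re_conj, im_conj. ring. }
    specialize (HM t ltac:(lra)).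
    apply Rmult_le_reg_l with (Cmod u); [lra |].
    rewrite He.
    apply Rle_trans with (Cmod u * Cmod (df t) * (y - x))%R.
    + apply Rmult_le_compat_r; lra.
    + assert (Cmod (df t) * (y - x) <= M * (y - x))%R by (apply Rmult_le_compat_r; lra). nra.
Qed.

Lemma is_derive_RC_const (k : C) (x : R) : is_derive_RC (fun _ => k) x 0.
Proof. split; apply @is_derive_const. Qed.

Lemma is_derive_RC_plus (f g : R -> C) (x : R) (l m : C) :
  is_derive_RC f x l -> is_derive_RC g x m -> is_derive_RC (fun t => f t + g t) x (l + m).
Proof. intros [H1 H2] [H3 H4]; split; apply @is_derive_plus; assumption. Qed.

Lemma is_derive_RC_mult (f g : R -> C) (x : R) (l m : C) :
  is_derive_RC f x l -> is_derive_RC g x m -> is_derive_RC (fun t => f t * g t) x (l * g x + f x * m).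
Proof.
  intros [H1 H2] [H3 H4]; split.
  - apply (is_derive_ext (fun t => minus (mult (Re (f t)) (Re (g t))) (mult (Im (f t)) (Im (g t))))%R).
    { intros t. reflexivity. }
    replace (Re (l * g x + f x * m)) with
      (minus (plus (mult (Re l) (Re (g x))) (mult (Re (f x)) (Re m)))
        (plus (mult (Im l) (Im (g x))) (mult (Im (f x)) (Im m)))).
    { apply @is_derive_minus; apply @is_derive_mult; try assumption; intros; apply Rmult_comm. }
    rewrite re_plus, !re_mult. unfold minus, plus, opp, mult; simpl. unfold mult; simpl. ring.
  - apply (is_derive_ext (fun t => plus (mult (Re (f t)) (Im (g t))) (mult (Im (f t)) (Re (g t))))%R).
    { intros t. reflexivity. }
    replace (Im (l * g x + f x * m)) with
      (plus (plus (mult (Re l) (Im (g x))) (mult (Re (f x)) (Im m)))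
        (plus (mult (Im l) (Re (g x))) (mult (Im (f x)) (Re m)))).
    { apply @is_derive_plus; apply @is_derive_mult; try assumption; intros; apply Rmult_comm. }
    rewrite im_plus, !im_mult. unfold minus, plus, opp, mult; simpl. unfold mult; simpl. ring.
Qed.

Lemma is_derive_RC_comp (f : R -> C) (g : R -> R) (x dg : R) (l : C) :
  is_derive_RC f (g x) l -> is_derive g x dg -> is_derive_RC (fun t => f (g t)) x (RtoC dg * l).
Proof.
  intros [H1 H2] Hg; split.
  - rewrite re_scal_l. apply (is_derive_comp (fun t => Re (f t)) g); assumption.
  - rewrite im_scal_l. apply (is_derive_comp (fun t => Im (f t)) g); assumption.
Qed.

Lemma is_derive_RC_RtoC (g : R -> R) (x d : R) : is_derive g x d -> is_derive_RC (fun t => RtoC (g t)) x (RtoC d).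
Proof.
  intros H; split; [exact H |]. exact (is_derive_const (V:=R_NormedModule) 0%R x).
Qed.

Lemma is_derive_RC_id (t : R) : is_derive_RC RtoC t 1.
Proof. apply (is_derive_RC_RtoC (fun t => t)). exact (is_derive_id (K := R_AbsRing) t). Qed.

Lemma is_derive_RC_eq (f : R -> C) (x : R) (l l' : C) : is_derive_RC f x l -> l = l' -> is_derive_RC f x l'.
Proof. intros H <-. exact H. Qed.

Lemma is_derive_RC_ext (f g : R -> C) (x : R) (l : C) : (forall t, f t = g t) -> is_derive_RC f x l -> is_derive_RC g x l.
Proof.
  intros E [H1 H2]; split; (eapply is_derive_ext; [| eassumption]); intros t; cbv beta; rewrite E; reflexivity.
Qed.

Lemma Re_Cexp (z : C) : Re (Cexp z) = (exp (Re z) * cos (Im z))%R.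
Proof. unfold Cexp. rewrite re_scal_l. reflexivity. Qed.
Lemma Im_Cexp (z : C) : Im (Cexp z) = (exp (Re z) * sin (Im z))%R.
Proof. unfold Cexp. rewrite im_scal_l. reflexivity. Qed.

Lemma C_eq (z w : C) : Re z = Re w -> Im z = Im w -> z = w.
Proof. destruct z, w; simpl; intros -> ->; reflexivity. Qed.

Lemma Cexp_plus (z w : C) : Cexp (z + w) = Cexp z * Cexp w.
Proof.
  apply C_eq.
  - rewrite re_mult, !Re_Cexp, !Im_Cexp, re_plus, im_plus, exp_plus, cos_plus. ring.
  - rewrite im_mult, !Re_Cexp, !Im_Cexp, re_plus, im_plus, exp_plus, sin_plus. ring.
Qed.

Lemma Cexp_0 : Cexp 0 = 1.
Proof.
  apply C_eq; [rewrite Re_Cexp | rewrite Im_Cexp]; simpl; rewrite exp_0, ?cos_0, ?sin_0; ring.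
Qed.

Lemma Cmod_Cexp (z : C) : Cmod (Cexp z) = exp (Re z).
Proof.
  unfold Cexp. rewrite Cmod_mult, Cmod_R, Rabs_pos_eq by (left; apply exp_pos).
  unfold Cmod; simpl. replace (_ + _)%R with 1%R. { rewrite sqrt_1. ring. }
  pose proof (sin2_cos2 (Im z)) as H. unfold Rsqr in H. lra.
Qed.

Lemma Cexp_neq_0 (z : C) : Cexp z <> 0.
Proof.
  apply Cmod_gt_0. rewrite Cmod_Cexp. apply exp_pos.
Qed.

Lemma Cexp_opp (z : C) : Cexp (- z) = / Cexp z.
Proof.
  pose proof (Cexp_neq_0 z).
  assert (E : Cexp (- z) * Cexp z = 1) by (rewrite <- Cexp_plus, <- Cexp_0; f_equal; ring).
  rewrite <- (Cmult_1_r (Cexp (- z))), <- (Cinv_r (Cexp z)) by assumption.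
  rewrite Cmult_assoc, E. ring.
Qed.

Lemma is_derive_RC_Cexp (w : C) (t : R) : is_derive_RC (fun t => Cexp (RtoC t * w)) t (w * Cexp (RtoC t * w)).
Proof.
  split.
  - apply (is_derive_ext (fun t => exp (t * Re w) * cos (t * Im w))%R).
    { intros u. rewrite Re_Cexp, re_scal_l, im_scal_l. reflexivity. }
    rewrite re_mult, Re_Cexp, Im_Cexp, re_scal_l, im_scal_l.
    auto_derive; [trivial |]. ring.
  - apply (is_derive_ext (fun t => exp (t * Re w) * sin (t * Im w))%R).
    { intros u. rewrite Im_Cexp, re_scal_l, im_scal_l. reflexivity. }
    rewrite im_mult, Re_Cexp, Im_Cexp, re_scal_l, im_scal_l.
    auto_derive; [trivial |]. ring.
Qed.

Lemma Re_scal_le_Cmod (t : R) (w : C) : (0 <= t <= 1)%R -> (Re (RtoC t * w) <= Cmod w)%R.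
Proof.
  intros Ht. rewrite re_scal_l.
  pose proof (re_le_Cmod w). pose proof (Rle_abs (Re w)). pose proof (Cmod_ge_0 w).
  destruct (Rle_dec 0 (Re w)); nra.
Qed.

(** Mean value inequality along the segment from 0 to w, where the derivative of
    t |-> exp(t w) has modulus at most |w| exp |w|. *)
Lemma Cexp_sub1_bound (w : C) : (Cmod (Cexp w - 1) <= Cmod w * exp (Cmod w))%R.
Proof.
  pose proof (is_derive_RC_mvt (fun t => Cexp (RtoC t * w)) (fun t => w * Cexp (RtoC t * w)) 0 1
    (Cmod w * exp (Cmod w)) ltac:(lra)) as H.
  cbv beta in H. rewrite Cmult_1_l, Cmult_0_l, Cexp_0 in H.
  replace (Cmod w * exp (Cmod w))%R with (Cmod w * exp (Cmod w) * (1 - 0))%R by ring.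
  apply H.
  - intros t _. apply is_derive_RC_Cexp.
  - intros t Ht. rewrite Cmod_mult, Cmod_Cexp. apply Rmult_le_compat_l; [apply Cmod_ge_0 |].
    apply exp_le. now apply Re_scal_le_Cmod.
Qed.

(** Same segment; the derivative of t |-> exp(t w) - 1 - t w is w (exp(t w) - 1),
    to which the first-order bound applies. *)
Lemma Cexp_taylor_bound (w : C) : (Cmod (Cexp w - 1 - w) <= Cmod w ^ 2 * exp (Cmod w))%R.
Proof.
  pose proof (is_derive_RC_mvt (fun t => Cexp (RtoC t * w) + (- 1 + RtoC t * (- w)))
    (fun t => w * Cexp (RtoC t * w) + (0 + (1 * (- w) + RtoC t * 0))) 0 1
    (Cmod w ^ 2 * exp (Cmod w)) ltac:(lra)) as H.
  cbv beta in H. rewrite !Cmult_1_l, !Cmult_0_l, Cexp_0 in H.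
  replace (Cmod w ^ 2 * exp (Cmod w))%R with (Cmod w ^ 2 * exp (Cmod w) * (1 - 0))%R by ring.
  replace (Cexp w - 1 - w) with (Cexp w + (-1 + - w) - (1 + (-1 + 0))) by ring.
  apply H.
  - intros t _. apply is_derive_RC_plus; [apply is_derive_RC_Cexp |]. apply is_derive_RC_plus; [apply is_derive_RC_const |].
    eapply is_derive_RC_eq; [apply (is_derive_RC_mult RtoC (fun _ => - w)) |].
    + apply is_derive_RC_id.
    + apply is_derive_RC_const.
    + ring.
  - intros t Ht. replace (w * Cexp (t * w) + (0 + (- w + t * 0))) with (w * (Cexp (t * w) - 1)) by ring.
    rewrite Cmod_mult. simpl. rewrite Rmult_1_r, Rmult_assoc.
    apply Rmult_le_compat_l; [apply Cmod_ge_0 |].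
    eapply Rle_trans; [apply Cexp_sub1_bound |].
    assert (Cmod (t * w) <= Cmod w)%R.
    { rewrite Cmod_mult, Cmod_R, Rabs_pos_eq by lra. pose proof (Cmod_ge_0 w). nra. }
    apply Rmult_le_compat; [apply Cmod_ge_0 | left; apply exp_pos | assumption | now apply exp_le].
Qed.

Lemma is_derive_Cexp (z : C) : is_derive Cexp z (Cexp z).
Proof.
  apply is_derive_C_iff. intros eps Heps.
  set (K := (Cmod (Cexp z) * exp 1 + 1)%R).
  assert (HK : (0 < K)%R).
  { unfold K. pose proof (Cmod_ge_0 (Cexp z)). pose proof (exp_pos 1). nra. }
  exists (Rmin 1 (eps / K))%R. split.
  { apply Rmin_pos; [lra |]. now apply Rdiv_lt_0_compat. }
  intros w Hw.
  pose proof (Rmin_l 1 (eps / K)). pose proof (Rmin_r 1 (eps / K)).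
  set (h := w - z) in *.
  replace (Cexp w - Cexp z - h * Cexp z) with (Cexp z * (Cexp h - 1 - h)).
  2: { replace w with (z + h) by (unfold h; ring). rewrite Cexp_plus. ring. }
  rewrite Cmod_mult.
  pose proof (Cexp_taylor_bound h). pose proof (Cmod_ge_0 h).
  assert (exp (Cmod h) <= exp 1)%R by (apply exp_le; lra).
  assert (Cmod h * K <= eps)%R.
  { apply Rle_trans with (eps / K * K)%R; [apply Rmult_le_compat_r; lra |]. right. field. lra. }
  pose proof (Cmod_ge_0 (Cexp z)).
  apply Rle_trans with (Cmod (Cexp z) * (Cmod h ^ 2 * exp 1))%R.
  { apply Rmult_le_compat_l; [assumption |]. eapply Rle_trans; [eassumption |].
    apply Rmult_le_compat_l; [apply pow2_ge_0 | assumption]. }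
  replace (Cmod (Cexp z) * (Cmod h ^ 2 * exp 1))%R with ((Cmod h * (Cmod (Cexp z) * exp 1)) * Cmod h)%R by ring.
  apply Rmult_le_compat_r; [assumption |].
  eapply Rle_trans; [| eassumption]. apply Rmult_le_compat_l; [assumption |]. unfold K; lra.
Qed.

(** * Goursat's theorem on rectangles *)

Notation CInt := (RInt (V := C_R_CompleteNormedModule)).

Lemma is_derive_continuous_C (f : C -> C) (z l : C) :
  is_derive f z l -> filterlim f (locally z) (locally (f z)).
Proof.
  intros H. apply filterlim_locally. intros eps.
  destruct (proj1 (is_derive_C_iff f z l) H 1%R Rlt_0_1) as [d [Hd H']].
  set (K := (Cmod l + 2)%R).
  assert (HK : (0 < K)%R) by (unfold K; pose proof (Cmod_ge_0 l); lra).
  assert (Hr : (0 < Rmin d (eps / K))%R).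
  { apply Rmin_pos; [assumption |]. apply Rdiv_lt_0_compat; [apply cond_pos | assumption]. }
  apply locally_C. exists (mkposreal _ Hr). intros w Hw.
  change (Cmod (w - z) < Rmin d (eps / K))%R in Hw.
  pose proof (Rmin_l d (eps / K)). pose proof (Rmin_r d (eps / K)).
  apply C_NormedModule_mixin_compat1.
  change (Cmod (f w - f z) < eps)%R.
  specialize (H' w ltac:(lra)).
  replace (f w - f z) with ((f w - f z - (w - z) * l) + (w - z) * l) by ring.
  eapply Rle_lt_trans; [apply Cmod_triangle |]. rewrite Cmod_mult.
  pose proof (Cmod_ge_0 (w - z)).
  assert (Cmod (w - z) * K < eps)%R.
  { replace (pos eps) with (eps / K * K)%R by (field; lra). apply Rmult_lt_compat_r; lra. }
  unfold K in *. nra.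
Qed.

Lemma continuous_horizontal (f : C -> C) (x y : R) :
  filterlim f (locally (x, y)) (locally (f (x, y))) ->
  continuous (U := C_R_CompleteNormedModule) (fun t : R => f (t, y)) x.
Proof.
  intros H P HP. destruct (H P HP) as [d Hd]. exists d. intros t Ht.
  apply Hd. split; [exact Ht | apply ball_center].
Qed.

Lemma continuous_vertical (f : C -> C) (x y : R) :
  filterlim f (locally (x, y)) (locally (f (x, y))) ->
  continuous (U := C_R_CompleteNormedModule) (fun t : R => f (x, t)) y.
Proof.
  intros H P HP. destruct (H P HP) as [d Hd]. exists d. intros t Ht.
  apply Hd. split; [apply ball_center | exact Ht].
Qed.

(** The integral of g dz along the positively oriented boundary of [a,b] x [c,d]. *)
Definition rect_integral (g : C -> C) (a b c d : R) : C :=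
  CInt (fun x => g (x, c)) a b - CInt (fun x => g (x, d)) a b
  + Ci * (CInt (fun y => g (b, y)) c d - CInt (fun y => g (a, y)) c d).

Definition holomorphic_on (g : C -> C) (a b c d : R) : Prop :=
  forall x y : R, (a <= x <= b)%R -> (c <= y <= d)%R -> ex_derive g (x, y).

Lemma ex_CInt_horizontal g A B C0 D a b y :
  holomorphic_on g A B C0 D -> (A <= a)%R -> (a <= b)%R -> (b <= B)%R -> (C0 <= y <= D)%R ->
  ex_RInt (V := C_R_CompleteNormedModule) (fun x => g (x, y)) a b.
Proof.
  intros H ? ? ? ?. apply (ex_RInt_continuous (V := C_R_CompleteNormedModule)).
  rewrite Rmin_left, Rmax_right by assumption. intros x Hx. apply continuous_horizontal.
  destruct (H x y ltac:(lra) ltac:(lra)) as [l Hl]. eapply is_derive_continuous_C, Hl.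
Qed.

Lemma ex_CInt_vertical g A B C0 D c d x :
  holomorphic_on g A B C0 D -> (C0 <= c)%R -> (c <= d)%R -> (d <= D)%R -> (A <= x <= B)%R ->
  ex_RInt (V := C_R_CompleteNormedModule) (fun y => g (x, y)) c d.
Proof.
  intros H ? ? ? ?. apply (ex_RInt_continuous (V := C_R_CompleteNormedModule)).
  rewrite Rmin_left, Rmax_right by assumption. intros y Hy. apply continuous_vertical.
  destruct (H x y ltac:(lra) ltac:(lra)) as [l Hl]. eapply is_derive_continuous_C, Hl.
Qed.

Lemma CInt_Chasles (f : R -> C) (a b c : R) :
  ex_RInt (V := C_R_CompleteNormedModule) f a b ->
  ex_RInt (V := C_R_CompleteNormedModule) f b c ->
  CInt f a c = CInt f a b + CInt f b c.
Proof. intros H1 H2. symmetry. exact (RInt_Chasles (V := C_R_CompleteNormedModule) f a b c H1 H2). Qed.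

Lemma rect_integral_split (g : C -> C) (a m b c k d : R) :
  holomorphic_on g a b c d -> (a <= m <= b)%R -> (c <= k <= d)%R ->
  rect_integral g a b c d =
  rect_integral g a m c k + rect_integral g m b c k + rect_integral g a m k d + rect_integral g m b k d.
Proof.
  intros H Hm Hk. unfold rect_integral.
  rewrite (CInt_Chasles (fun x => g (x, c)) a m b) by (eapply ex_CInt_horizontal; [exact H | lra ..]).
  rewrite (CInt_Chasles (fun x => g (x, d)) a m b) by (eapply ex_CInt_horizontal; [exact H | lra ..]).
  rewrite (CInt_Chasles (fun y => g (a, y)) c k d) by (eapply ex_CInt_vertical; [exact H | lra ..]).
  rewrite (CInt_Chasles (fun y => g (b, y)) c k d) by (eapply ex_CInt_vertical; [exact H | lra ..]).
  ring.
Qed.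

Lemma norm_C_R (z : C) : norm (V := C_R_NormedModule) z = Cmod z.
Proof.
  unfold norm; simpl. unfold prod_norm, Cmod. unfold norm; simpl. unfold abs; simpl.
  f_equal. rewrite ?Rmult_1_r. rewrite <- 2!Rabs_mult.
  rewrite ?Rabs_pos_eq; trivial; apply Rle_0_sqr.
Qed.

Lemma CInt_norm_sub (f g : R -> C) (k : C) (a b M : R) :
  (a <= b)%R ->
  ex_RInt (V := C_R_CompleteNormedModule) f a b ->
  ex_RInt (V := C_R_CompleteNormedModule) g a b ->
  (forall x, (a <= x <= b)%R -> (Cmod (f x - g x - k) <= M)%R) ->
  (Cmod (CInt f a b - CInt g a b - RtoC (b - a) * k) <= (b - a) * M)%R.
Proof.
  intros Hab Hf Hg HM.
  rewrite <- norm_C_R.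
  refine (norm_RInt_le_const (V := C_R_NormedModule) (fun x => f x - g x - k) a b _ M Hab _ _).
  { intros x Hx. rewrite norm_C_R. now apply HM. }
  rewrite <- scal_R_Cmult.
  apply (is_RInt_minus (V := C_R_NormedModule) (fun x => f x - g x) (fun _ => k)).
  - apply (is_RInt_minus (V := C_R_NormedModule) f g).
    + apply (RInt_correct (V := C_R_CompleteNormedModule)); assumption.
    + apply (RInt_correct (V := C_R_CompleteNormedModule)); assumption.
  - apply (is_RInt_const (V := C_R_NormedModule)).
Qed.

Lemma Cmod_pair_le (x y : R) : (Cmod (x, y) <= Rabs x + Rabs y)%R.
Proof.
  replace ((x, y) : C) with (RtoC x + Ci * RtoC y) by (apply C_eq; simpl; ring).
  eapply Rle_trans; [apply Cmod_triangle |]. rewrite Cmod_mult, Cmod_Ci, !Cmod_R. lra.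
Qed.

(** For an affine integrand the differences between opposite sides are constant and
    their contributions cancel.  What remains is the error term of
    differentiability, of size eps * |z - z0|, integrated over the boundary. *)
Lemma rect_integral_local (g : C -> C) (x y : R) (l : C) (eps : R) :
  (0 < eps)%R -> is_derive g (x, y) l ->
  exists delta : R, (0 < delta)%R /\
  forall a b c d, (a <= x <= b)%R -> (c <= y <= d)%R -> (b - a < delta)%R -> (d - c < delta)%R ->
    holomorphic_on g a b c d ->
    (Cmod (rect_integral g a b c d) <= eps * ((b - a) + (d - c)) ^ 2)%R.
Proof.
  intros Heps Hl.
  destruct (proj1 (is_derive_C_iff g (x, y) l) Hl (eps / 2)%R ltac:(lra)) as [r [Hr H]].
  exists (r / 2)%R. split; [lra |]. intros a b c d Hx Hy Hb Hd Hg.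
  set (s := ((b - a) + (d - c))%R).
  assert (Hs : forall u v, (a <= u <= b)%R -> (c <= v <= d)%R ->
    (Cmod (g (u, v) - g (x, y) - ((u, v) - (x, y)) * l) <= eps / 2 * s)%R).
  { intros u v Hu Hv.
    assert (Hm : (Cmod ((u, v) - (x, y)) <= s)%R).
    { eapply Rle_trans; [apply Cmod_pair_le |]. unfold s.
      apply Rplus_le_compat; apply Rabs_le; simpl; lra. }
    eapply Rle_trans; [apply H; unfold s in *; lra |].
    apply Rmult_le_compat_l; lra. }
  set (p := CInt (fun x => g (x, c)) a b - CInt (fun x => g (x, d)) a b - RtoC (b - a) * (Ci * RtoC (c - d) * l)).
  set (q := CInt (fun y => g (b, y)) c d - CInt (fun y => g (a, y)) c d - RtoC (d - c) * (RtoC (b - a) * l)).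
  assert (E : rect_integral g a b c d = p + Ci * q).
  { unfold rect_integral, p, q. rewrite !RtoC_minus. ring. }
  assert (Hp : (Cmod p <= (b - a) * (eps * s))%R).
  { unfold p. apply (CInt_norm_sub (fun x => g (x, c)) (fun x => g (x, d))); [lra | | |].
    1, 2: (eapply ex_CInt_horizontal; [exact Hg | lra ..]).
    intros u Hu.
    replace (g (u, c) - g (u, d) - Ci * RtoC (c - d) * l) with
      ((g (u, c) - g (x, y) - ((u, c) - (x, y)) * l) + - (g (u, d) - g (x, y) - ((u, d) - (x, y)) * l)).
    - eapply Rle_trans; [apply Cmod_triangle |]. rewrite Cmod_opp.
      pose proof (Hs u c Hu ltac:(lra)). pose proof (Hs u d Hu ltac:(lra)). lra.
    - replace (Ci * RtoC (c - d)) with ((u, c) - (u, d)) by (apply C_eq; simpl; ring). ring. }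
  assert (Hq : (Cmod q <= (d - c) * (eps * s))%R).
  { unfold q. apply (CInt_norm_sub (fun y => g (b, y)) (fun y => g (a, y))); [lra | | |].
    1, 2: (eapply ex_CInt_vertical; [exact Hg | lra ..]).
    intros u Hu.
    replace (g (b, u) - g (a, u) - RtoC (b - a) * l) with
      ((g (b, u) - g (x, y) - ((b, u) - (x, y)) * l) + - (g (a, u) - g (x, y) - ((a, u) - (x, y)) * l)).
    - eapply Rle_trans; [apply Cmod_triangle |]. rewrite Cmod_opp.
      pose proof (Hs b u ltac:(lra) Hu). pose proof (Hs a u ltac:(lra) Hu). lra.
    - replace (RtoC (b - a)) with ((b, u) - (a, u)) by (apply C_eq; simpl; ring). ring. }
  rewrite E. eapply Rle_trans; [apply Cmod_triangle |]. rewrite Cmod_mult, Cmod_Ci.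
  unfold s in *. nra.
Qed.

Record box := Box { bl : R; br : R; bb : R; bt : R }.

(** Failure on a box is inherited by one of its four quarters.  Repeated
    quartering gives nested boxes shrinking to a point (x, y), where the local
    hypothesis is contradicted. *)
Lemma box_bisection (P : box -> Prop) (a b c d : R) :
  (a <= b)%R -> (c <= d)%R ->
  (forall a b c d, (a <= b)%R -> (c <= d)%R ->
    let m := ((a + b) / 2)%R in let k := ((c + d) / 2)%R in
    P (Box a m c k) -> P (Box m b c k) -> P (Box a m k d) -> P (Box m b k d) -> P (Box a b c d)) ->
  (forall x y, (a <= x <= b)%R -> (c <= y <= d)%R ->
    exists delta, (0 < delta)%R /\ forall a' b' c' d',
      (a <= a')%R -> (b' <= b)%R -> (c <= c')%R -> (d' <= d)%R ->
      (a' <= x <= b')%R -> (c' <= y <= d')%R ->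
      (b' - a' < delta)%R -> (d' - c' < delta)%R -> P (Box a' b' c' d')) ->
  P (Box a b c d).
Proof.
  intros Hab Hcd Hsplit Hloc. apply NNPP. intros Hbad.
  set (ok := fun B => (bl B <= br B)%R /\ (bb B <= bt B)%R /\ ~ P B).
  set (half := fun B B' =>
    ((br B' - bl B') = (br B - bl B) / 2)%R /\ ((bt B' - bb B') = (bt B - bb B) / 2)%R /\
    (bl B <= bl B')%R /\ (br B' <= br B)%R /\ (bb B <= bb B')%R /\ (bt B' <= bt B)%R).
  assert (Hstep : forall B : {B | ok B}, exists B' : {B | ok B}, half (proj1_sig B) (proj1_sig B')).
  { intros [[x1 x2 y1 y2] [H1 [H2 H3]]]; simpl in *.
    set (m := ((x1 + x2) / 2)%R). set (k := ((y1 + y2) / 2)%R).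
    assert (Hq : forall p q r s, ((p, q) = (x1, m) \/ (p, q) = (m, x2)) ->
       ((r, s) = (y1, k) \/ (r, s) = (k, y2)) -> ~ P (Box p q r s) ->
       exists B' : {B | ok B}, half (Box x1 x2 y1 y2) (proj1_sig B')).
    { intros p q r s Hpq Hrs Hn.
      assert (Ho : ok (Box p q r s)).
      { unfold ok; simpl. unfold m, k in *.
        destruct Hpq as [E | E], Hrs as [E' | E']; injection E as -> ->; injection E' as -> ->; repeat split; auto; lra. }
      exists (exist _ _ Ho). unfold half; simpl. unfold m, k in *.
      destruct Hpq as [E | E], Hrs as [E' | E']; injection E as -> ->; injection E' as -> ->; repeat split; lra. }
    destruct (classic (P (Box x1 m y1 k))) as [P1 | P1]; [| eapply Hq; [| | exact P1]; auto].
    destruct (classic (P (Box m x2 y1 k))) as [P2 | P2]; [| eapply Hq; [| | exact P2]; auto].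
    destruct (classic (P (Box x1 m k y2))) as [P3 | P3]; [| eapply Hq; [| | exact P3]; auto].
    destruct (classic (P (Box m x2 k y2))) as [P4 | P4]; [| eapply Hq; [| | exact P4]; auto].
    exfalso. apply H3. apply Hsplit; assumption. }
  set (next := fun B => proj1_sig (constructive_indefinite_description _ (Hstep B))).
  assert (Hnext : forall B, half (proj1_sig B) (proj1_sig (next B))).
  { intros B. exact (proj2_sig (constructive_indefinite_description _ (Hstep B))). }
  assert (Hok0 : ok (Box a b c d)) by (unfold ok; simpl; auto).
  set (sq := fun n => proj1_sig (Nat.iter n next (exist _ _ Hok0))).
  assert (Hsq : forall n, half (sq n) (sq (S n))) by (intros n; apply Hnext).
  assert (Hokn : forall n, ok (sq n)) by (intros n; exact (proj2_sig (Nat.iter n next (exist _ _ Hok0)))).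
  assert (Hsize : forall n, (br (sq n) - bl (sq n) = (b - a) / 2 ^ n)%R /\
                            (bt (sq n) - bb (sq n) = (d - c) / 2 ^ n)%R).
  { induction n as [| n [IH1 IH2]].
    - simpl. split; field.
    - destruct (Hsq n) as [-> [-> _]]. rewrite IH1, IH2. simpl. split; field; apply pow_nonzero; lra. }
  assert (Hmono : forall n j, (bl (sq n) <= bl (sq (n + j)%nat))%R /\ (br (sq (n + j)%nat) <= br (sq n))%R /\
     (bb (sq n) <= bb (sq (n + j)%nat))%R /\ (bt (sq (n + j)%nat) <= bt (sq n))%R).
  { intros n. induction j as [| j IH].
    - rewrite Nat.add_0_r. repeat split; lra.
    - rewrite Nat.add_succ_r. pose proof (Hsq (n + j)%nat%nat) as Hh. unfold half in Hh. repeat split; lra. }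
  assert (Hcross : forall n m, (bl (sq n) <= br (sq m))%R /\ (bb (sq n) <= bt (sq m))%R).
  { intros n m. pose proof (Hmono n m). pose proof (Hmono m n) as H0. rewrite Nat.add_comm in H0.
    destruct (Hokn (n + m)%nat) as [? [? _]]. split; lra. }
  destruct (completeness (fun x => exists n, x = bl (sq n))) as [x [Hx1 Hx2]].
  { exists (br (sq O)). intros t [n ->]. now apply Hcross. }
  { exists (bl (sq O)). now exists O. }
  destruct (completeness (fun x => exists n, x = bb (sq n))) as [y [Hy1 Hy2]].
  { exists (bt (sq O)). intros t [n ->]. now apply Hcross. }
  { exists (bb (sq O)). now exists O. }
  assert (Hx : forall n, (bl (sq n) <= x <= br (sq n))%R).
  { intros n. split; [apply Hx1; now exists n |]. apply Hx2. intros t [m ->]. now apply Hcross. }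
  assert (Hy : forall n, (bb (sq n) <= y <= bt (sq n))%R).
  { intros n. split; [apply Hy1; now exists n |]. apply Hy2. intros t [m ->]. now apply Hcross. }
  destruct (Hloc x y (Hx O) (Hy O)) as [delta [Hdelta HP]].
  assert (Hsmall : exists n, ((b - a + (d - c)) / 2 ^ n < delta)%R).
  { destruct (cv_pow_half (b - a + (d - c)) delta Hdelta) as [n Hn].
    exists n. specialize (Hn n (le_n n)). unfold Rdist in Hn. rewrite Rminus_0_r in Hn.
    eapply Rle_lt_trans; [apply Rle_abs | exact Hn]. }
  destruct Hsmall as [n Hn].
  destruct (Hsize n) as [S1 S2]. destruct (Hokn n) as [O1 [O2 O3]].
  pose proof (Hmono O n) as Hm. simpl in Hm.
  assert (Hpos : (0 < 2 ^ n)%R) by (apply pow_lt; lra).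
  assert (E : ((b - a + (d - c)) / 2 ^ n = (b - a) / 2 ^ n + (d - c) / 2 ^ n)%R) by (field; lra).
  apply O3. specialize (Hx n). specialize (Hy n). destruct (sq n) as [x1 x2 y1 y2]; simpl in *.
  change (bl (sq O)) with a in Hm. change (br (sq O)) with b in Hm.
  change (bb (sq O)) with c in Hm. change (bt (sq O)) with d in Hm.
  apply HP; lra.
Qed.

(** The bound eps * (half perimeter)^2 is preserved by quartering: each quarter has
    half the perimeter, and four quarters of the square make up the square. *)
Theorem goursat (g : C -> C) (a b c d : R) :
  (a <= b)%R -> (c <= d)%R -> holomorphic_on g a b c d -> rect_integral g a b c d = 0.
Proof.
  intros Hab Hcd Hg.
  assert (H : forall eps, (0 < eps)%R -> (Cmod (rect_integral g a b c d) <= eps * ((b - a) + (d - c)) ^ 2)%R).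
  { intros eps Heps.
    refine (box_bisection (fun B => (a <= bl B -> br B <= b -> c <= bb B -> bt B <= d ->
       Cmod (rect_integral g (bl B) (br B) (bb B) (bt B)) <= eps * ((br B - bl B) + (bt B - bb B)) ^ 2)%R)
       a b c d Hab Hcd _ _ (Rle_refl _) (Rle_refl _) (Rle_refl _) (Rle_refl _)); simpl.
    - intros x1 x2 y1 y2 Hx Hy I1 I2 I3 I4 B1 B2 B3 B4.
      set (m := ((x1 + x2) / 2)%R) in *. set (k := ((y1 + y2) / 2)%R) in *.
      assert (Hm : (x1 <= m <= x2)%R) by (unfold m; lra).
      assert (Hk : (y1 <= k <= y2)%R) by (unfold k; lra).
      rewrite (rect_integral_split g x1 m x2 y1 k y2); [| intros u v Hu Hv; apply Hg; lra | assumption ..].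
      specialize (I1 ltac:(lra) ltac:(lra) ltac:(lra) ltac:(lra)).
      specialize (I2 ltac:(lra) ltac:(lra) ltac:(lra) ltac:(lra)).
      specialize (I3 ltac:(lra) ltac:(lra) ltac:(lra) ltac:(lra)).
      specialize (I4 ltac:(lra) ltac:(lra) ltac:(lra) ltac:(lra)).
      replace (m - x1)%R with ((x2 - x1) / 2)%R in * by (unfold m; field).
      replace (x2 - m)%R with ((x2 - x1) / 2)%R in * by (unfold m; field).
      replace (k - y1)%R with ((y2 - y1) / 2)%R in * by (unfold k; field).
      replace (y2 - k)%R with ((y2 - y1) / 2)%R in * by (unfold k; field).
      eapply Rle_trans; [apply Cmod_triangle |].
      eapply Rle_trans; [apply Rplus_le_compat_r, Cmod_triangle |].
      eapply Rle_trans; [apply Rplus_le_compat_r, Rplus_le_compat_r, Cmod_triangle |].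
      nra.
    - intros x y Hx Hy. destruct (Hg x y Hx Hy) as [l Hl].
      destruct (rect_integral_local g x y l eps Heps Hl) as [delta [Hd H]].
      exists delta. split; [assumption |]. intros. apply H; try lra.
      intros u v Hu Hv. apply Hg; lra. }
  apply Cmod_eq_0. apply Rle_antisym; [| apply Cmod_ge_0].
  apply le_epsilon. intros eps Heps. rewrite Rplus_0_l.
  set (S := (((b - a) + (d - c)) ^ 2)%R) in *.
  assert (HS : (0 <= S)%R) by apply pow2_ge_0.
  eapply Rle_trans; [apply (H (eps / (S + 1))%R); apply Rdiv_lt_0_compat; lra |].
  apply Rle_trans with (eps / (S + 1) * (S + 1))%R; [| right; field; lra].
  apply Rmult_le_compat_l; [| lra]. left. apply Rdiv_lt_0_compat; lra.
Qed.

(** * Unique continuation from a half plane *)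

Lemma CInt_norm_le (f : R -> C) (a b M : R) :
  (a <= b)%R -> ex_RInt (V := C_R_CompleteNormedModule) f a b ->
  (forall x, (a <= x <= b)%R -> (Cmod (f x) <= M)%R) ->
  (Cmod (CInt f a b) <= (b - a) * M)%R.
Proof.
  intros Hab Hf HM. rewrite <- norm_C_R.
  apply (norm_RInt_le_const (V := C_R_NormedModule) f a b _ M Hab).
  - intros x Hx. rewrite norm_C_R. now apply HM.
  - apply (RInt_correct (V := C_R_CompleteNormedModule)). assumption.
Qed.

Lemma Re_CInt (f : R -> C) (a b : R) :
  ex_RInt (V := C_R_CompleteNormedModule) f a b ->
  Re (CInt f a b) = RInt (fun x => Re (f x)) a b.
Proof.
  intros Hf. symmetry. apply is_RInt_unique.
  apply (is_RInt_fct_extend_fst (U := R_NormedModule) (V := R_NormedModule) f).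
  apply (RInt_correct (V := C_R_CompleteNormedModule)). assumption.
Qed.

Lemma RInt_ge_const (f : R -> R) (a b m : R) :
  (a <= b)%R -> ex_RInt f a b -> (forall x, (a < x < b)%R -> (m <= f x)%R) ->
  ((b - a) * m <= RInt f a b)%R.
Proof.
  intros Hab Hf Hm.
  replace ((b - a) * m)%R with (RInt (fun _ => m) a b) by apply (RInt_const (V := R_CompleteNormedModule)).
  apply RInt_le; [assumption | apply ex_RInt_const | assumption | assumption].
Qed.

(** With k >= 1/2 on |y - y0| <= d, the part |y - y0| <= d/2 contributes at least
    (d/2) exp(-L d^2/4).  The rest is at least -2 r K exp(-L d^2), where K bounds
    |k|, and A exp(-L) is at most |A| exp(-L d^2) because d <= 1.  The ratio
    exp(3 L d^2/4) of the two scales outgrows every constant. *)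
Lemma gaussian_concentration (k : R -> R) (y0 r A : R) :
  (0 < r)%R ->
  (forall y, (y0 - r <= y <= y0 + r)%R -> continuous k y) ->
  k y0 = 1%R ->
  ~ (forall L, (0 < L)%R ->
      (RInt (fun y => k y * exp (- L * (y - y0) ^ 2)) (y0 - r) (y0 + r) <= A * exp (- L))%R).
Proof.
  intros Hr Hk Hk0 HA.
  assert (Hdelta : exists d, (0 < d)%R /\ (d <= 1)%R /\ (d <= r)%R /\
    forall y, (Rabs (y - y0) <= d)%R -> (1 / 2 <= k y)%R).
  { assert (Hy0 : (y0 - r <= y0 <= y0 + r)%R) by lra.
    assert (Hhalf : (0 < 1 / 2)%R) by lra.
    destruct (proj1 (filterlim_locally k (k y0)) (Hk y0 Hy0) (mkposreal _ Hhalf)) as [d Hd].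
    exists (Rmin (d / 2) (Rmin 1 r))%R.
    pose proof (cond_pos d).
    pose proof (Rmin_l (d / 2) (Rmin 1 r)). pose proof (Rmin_r (d / 2) (Rmin 1 r)).
    pose proof (Rmin_l 1 r). pose proof (Rmin_r 1 r).
    repeat split; try lra.
    - repeat apply Rmin_pos; lra.
    - intros y Hy. assert (Hb : ball y0 d y).
      { change (Rabs (y - y0) < d)%R. lra. }
      specialize (Hd y Hb). change (Rabs (k y - k y0) < 1 / 2)%R in Hd.
      apply Rabs_lt_between in Hd. lra. }
  destruct Hdelta as [d [Hd [Hd1 [Hdr Hkd]]]].
  destruct (bounded_continuity (V := R_NormedModule) k (y0 - r) (y0 + r) Hk) as [K HK].
  assert (HK' : forall y, (y0 - r <= y <= y0 + r)%R -> (- K <= k y)%R).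
  { intros y Hy. specialize (HK y Hy). change (Rabs (k y) < K)%R in HK.
    apply Rabs_lt_between in HK. lra. }
  assert (HK0 : (0 <= K)%R).
  { specialize (HK y0 ltac:(lra)). change (Rabs (k y0) < K)%R in HK. pose proof (Rabs_pos (k y0)). lra. }
  set (B := (Rabs A + 2 * r * K)%R).
  assert (HB : (0 <= B)%R) by (unfold B; pose proof (Rabs_pos A); nra).
  (* With this L, the bound exp x >= 1 + x gives exp (3 L d^2/4) > (B + 1) (2/d). *)
  set (L := ((B + 1) * (2 / d) * (4 / (3 * d ^ 2)))%R).
  assert (Hd2 : (0 < d ^ 2)%R) by (apply pow_lt; assumption).
  assert (HL : (0 < L)%R).
  { unfold L. repeat apply Rmult_lt_0_compat; try lra; apply Rinv_0_lt_compat; lra. }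
  specialize (HA L HL). revert HA. apply Rlt_not_le.
  set (f := fun y => (k y * exp (- L * (y - y0) ^ 2))%R).
  assert (Hf : forall a b, (y0 - r <= a)%R -> (a <= b)%R -> (b <= y0 + r)%R -> ex_RInt f a b).
  { intros a b Ha Hab Hb. apply (ex_RInt_continuous (V := R_CompleteNormedModule)).
    rewrite Rmin_left, Rmax_right by assumption. intros y Hy.
    apply (continuous_mult k); [apply Hk; lra |].
    apply @ex_derive_continuous. auto_derive. trivial. }
  rewrite <- (RInt_Chasles (V := R_CompleteNormedModule) f (y0 - r) (y0 + d / 2) (y0 + r)) by (apply Hf; lra).
  rewrite <- (RInt_Chasles (V := R_CompleteNormedModule) f (y0 - r) (y0 - d / 2) (y0 + d / 2)) by (apply Hf; lra).
  change (A * exp (- L) < RInt f (y0 - r) (y0 - d / 2) + RInt f (y0 - d / 2) (y0 + d / 2) + RInt f (y0 + d / 2) (y0 + r))%R.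
  set (e := exp (- L * d ^ 2)). set (e' := exp (- L * (d / 2) ^ 2)).
  assert (He : (0 < e)%R) by apply exp_pos.
  assert (He' : (0 < e')%R) by apply exp_pos.
  assert (Hout : forall y, (y0 - r <= y <= y0 + r)%R -> (d / 2 <= Rabs (y - y0))%R -> (- K * e <= f y)%R).
  { intros y Hy Hyd. unfold f. pose proof (exp_pos (- L * (y - y0) ^ 2)).
    destruct (Rle_dec (Rabs (y - y0)) d) as [Hc | Hc].
    - specialize (Hkd y Hc). nra.
    - assert (exp (- L * (y - y0) ^ 2) <= e)%R.
      { apply exp_le. rewrite <- (pow2_abs (y - y0)). assert (d ^ 2 <= Rabs (y - y0) ^ 2)%R by (apply pow_incr; lra). nra. }
      specialize (HK' y Hy). nra. }
  assert (Hin : forall y, (Rabs (y - y0) <= d / 2)%R -> (1 / 2 * e' <= f y)%R).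
  { intros y Hy. unfold f. apply Rmult_le_compat; [lra | lra | apply Hkd; lra |].
    apply exp_le. rewrite <- (pow2_abs (y - y0)).
    assert (Rabs (y - y0) ^ 2 <= (d / 2) ^ 2)%R by (apply pow_incr; pose proof (Rabs_pos (y - y0)); lra). nra. }
  assert (I1 : ((y0 - d / 2 - (y0 - r)) * (- K * e) <= RInt f (y0 - r) (y0 - d / 2))%R).
  { apply RInt_ge_const; [lra | apply Hf; lra |]. intros y Hy. apply Hout; [lra |].
    rewrite Rabs_left by lra. lra. }
  assert (I2 : ((y0 + d / 2 - (y0 - d / 2)) * (1 / 2 * e') <= RInt f (y0 - d / 2) (y0 + d / 2))%R).
  { apply RInt_ge_const; [lra | apply Hf; lra |]. intros y Hy. apply Hin.
    apply Rabs_le. lra. }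
  assert (I3 : ((y0 + r - (y0 + d / 2)) * (- K * e) <= RInt f (y0 + d / 2) (y0 + r))%R).
  { apply RInt_ge_const; [lra | apply Hf; lra |]. intros y Hy. apply Hout; [lra |].
    rewrite Rabs_pos_eq by lra. lra. }
  assert (HeL : (exp (- L) <= e)%R).
  { apply exp_le. assert (d ^ 2 <= 1 ^ 2)%R by (apply pow_incr; lra). nra. }
  assert (HAe : (A * exp (- L) <= Rabs A * e)%R).
  { pose proof (Rle_abs A). pose proof (Rabs_pos A). pose proof (exp_pos (- L)).
    apply Rle_trans with (Rabs A * exp (- L))%R; nra. }
  assert (Hmain : (B * e < d / 2 * e')%R).
  { assert (E : e' = (e * exp (L * (3 / 4 * d ^ 2)))%R).
    { unfold e, e'. rewrite <- exp_plus. f_equal. field. }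
    rewrite E. pose proof (exp_ineq1_le (L * (3 / 4 * d ^ 2))) as Hexp.
    assert (E2 : (L * (3 / 4 * d ^ 2) = (B + 1) * (2 / d))%R) by (unfold L; field; lra).
    rewrite E2 in *. clearbody e.
    apply Rlt_le_trans with (d / 2 * (e * ((B + 1) * (2 / d))))%R.
    - replace (d / 2 * (e * ((B + 1) * (2 / d))))%R with (e * (B + 1))%R by (field; lra). nra.
    - apply Rmult_le_compat_l; [lra |]. apply Rmult_le_compat_l; lra. }
  unfold B in Hmain.
  assert (0 <= K * e)%R by nra. nra.
Qed.

(** C carries two normed-module structures over itself, with different balls but the
    same norm; the product rule is stated for one, holomorphy of zeta for the
    other. *)
Lemma is_derive_C_abs (f : C -> C) (z l : C) :
  is_derive (K := C_AbsRing) (V := AbsRing_NormedModule C_AbsRing) f z l <->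
  is_derive (K := C_AbsRing) (V := C_NormedModule) f z l.
Proof.
  split; intros [_ H]; (split; [apply is_linear_scal_l |]); exact H.
Qed.

Lemma is_derive_C_mult (f g : C -> C) (z l m : C) :
  is_derive f z l -> is_derive g z m -> is_derive (fun w => f w * g w) z (l * g z + f z * m).
Proof.
  intros Hf Hg.
  apply is_derive_C_abs. apply is_derive_C_abs in Hf. apply is_derive_C_abs in Hg.
  exact (is_derive_mult (K := C_AbsRing) f g z l m Hf Hg Cmult_comm).
Qed.

Lemma is_derive_C_id (z : C) : is_derive (K := C_AbsRing) (V := C_NormedModule) (fun w : C => w) z (RtoC 1).
Proof. apply is_derive_C_abs. exact (is_derive_id (K := C_AbsRing) z). Qed.

Lemma is_derive_C_const (k z : C) : is_derive (K := C_AbsRing) (V := C_NormedModule) (fun _ : C => k) z (RtoC 0).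
Proof. exact (is_derive_const (K := C_AbsRing) (V := C_NormedModule) k z). Qed.

(** Goursat's theorem for h(z) / h(z0) * exp(L (z - z0)^2) on
    [x0, b+1] x [y0-r, y0+r].  The right side carries no integral, since h
    vanishes there, and r exceeds the width w by 1, so that
    (x - x0)^2 - r^2 <= w^2 - (w+1)^2 <= -1 on the horizontal sides. *)
Theorem half_plane_unique_continuation (h : C -> C) (a b : R) :
  (forall z : C, (a < Re z)%R -> ex_derive h z) ->
  (forall z : C, (b < Re z)%R -> h z = 0) ->
  forall z : C, (a < Re z)%R -> h z = 0.
Proof.
  intros Hh Hb [x0 y0] Hz0. simpl in Hz0. apply NNPP. intros Hne.
  destruct (Rlt_le_dec b x0) as [Hlt | Hle]; [apply Hne, Hb, Hlt |].
  set (x1 := (b + 1)%R). set (w := (x1 - x0)%R). set (r := (w + 1)%R).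
  assert (Ew : w = (x1 - x0)%R) by reflexivity.
  assert (Er : r = (w + 1)%R) by reflexivity.
  assert (Hw : (1 <= w)%R) by (unfold w, x1; lra).
  clearbody w r.
  assert (Hcont : forall z, (a < Re z)%R -> filterlim h (locally z) (locally (h z))).
  { intros z Hz. destruct (Hh z Hz) as [l Hl]. eapply is_derive_continuous_C, Hl. }
  set (h0 := h (x0, y0)) in *.
  assert (HM : forall y, exists M, forall x, (x0 <= x <= x1)%R -> (Cmod (h (x, y)) <= M)%R).
  { intros y. destruct (bounded_continuity (V := C_R_NormedModule) (fun x => h (x, y)) x0 x1) as [M HM].
    - intros x Hx. apply continuous_horizontal, Hcont. simpl; lra.
    - exists M. intros x Hx. specialize (HM x Hx). rewrite norm_C_R in HM. lra. }
  destruct (HM (y0 - r)%R) as [M1 HM1]. destruct (HM (y0 + r)%R) as [M2 HM2].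
  set (A := (w * (M1 + M2) * / Cmod h0)%R).
  apply (gaussian_concentration (fun y => Re (h (x0, y) / h0)) y0 r A).
  - lra.
  - intros y Hy.
    apply (continuous_comp (fun y => h (x0, y)) (fun u => Re (u / h0))).
    + apply (continuous_vertical h), Hcont. exact Hz0.
    + apply (continuous_ext (fun u : C => (minus (mult (Re (/ h0)) (fst u)) (mult (Im (/ h0)) (snd u)))%R)).
      { intros u. unfold Cdiv. rewrite re_mult. unfold minus, plus, opp, mult; simpl. unfold mult; simpl.
        change (Re u) with (fst u). change (Im u) with (snd u). ring. }
      apply @continuous_minus; apply @continuous_scal_r; [apply continuous_fst | apply continuous_snd].
  - fold h0. unfold Cdiv. rewrite Cinv_r by assumption. reflexivity.
  - intros L HL.
    set (z0 := (x0, y0) : C).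
    set (g := fun z => h z / h0 * Cexp (RtoC L * ((z - z0) * (z - z0)))).
    assert (Hg : holomorphic_on g x0 x1 (y0 - r) (y0 + r)).
    { intros x y Hx Hy. destruct (Hh (x, y) ltac:(simpl; lra)) as [l Hl].
      assert (Hid : is_derive (K := C_AbsRing) (V := C_NormedModule) (fun z : C => z - z0) (x, y) (1 - 0)).
      { apply (is_derive_minus (K := C_AbsRing) (V := C_NormedModule) (fun z => z) (fun _ => z0)).
        - apply is_derive_C_id.
        - apply is_derive_C_const. }
      eexists. unfold g.
      apply is_derive_C_mult.
      - apply is_derive_C_mult; [exact Hl | apply is_derive_C_const].
      - apply (is_derive_comp (K := C_AbsRing) (V := C_NormedModule) Cexp); [apply is_derive_Cexp |].
        apply is_derive_C_abs, is_derive_C_mult; [apply is_derive_C_const |].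
        apply is_derive_C_mult; exact Hid. }
    pose proof (goursat g x0 x1 (y0 - r) (y0 + r) ltac:(lra) ltac:(lra) Hg) as HG.
    unfold rect_integral in HG.
    assert (Hright : CInt (fun y => g (x1, y)) (y0 - r) (y0 + r) = RtoC 0).
    { rewrite (RInt_ext (V := C_R_CompleteNormedModule) _ (fun _ => RtoC 0)).
      - rewrite (RInt_const (V := C_R_CompleteNormedModule)). rewrite scal_R_Cmult. apply Cmult_0_r.
      - intros y _. assert (E : g (x1, y) = 0).
        { unfold g. rewrite Hb by (simpl; unfold x1; lra). unfold Cdiv. ring. }
        exact E. }
    rewrite Hright in HG.
    set (I := CInt (fun y => g (x0, y)) (y0 - r) (y0 + r) : C) in *.
    set (I1 := CInt (fun x => g (x, (y0 - r)%R)) x0 x1 : C) in *.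
    set (I2 := CInt (fun x => g (x, (y0 + r)%R)) x0 x1 : C) in *.
    assert (HI : I = Ci * (I2 - I1)).
    { assert (E : Ci * (Ci * (0 - I)) = Ci * (I2 - I1)).
      { replace (I2 - I1) with (- (I1 - I2)) by ring.
        replace (Ci * (Ci * (0 - I))) with (Ci * (I1 - I2 + Ci * (0 - I) - (I1 - I2))) by ring.
        rewrite HG. ring. }
      change (@eq C I (Ci * (I2 - I1))). rewrite <- E. replace (Ci * (Ci * (0 - I))) with (- (Ci * Ci) * I) by ring.
      replace (Ci * Ci) with (- RtoC 1) by (apply C_eq; simpl; ring). ring. }
    assert (Hside : forall y M, (y = y0 - r \/ y = y0 + r)%R ->
      (forall x, (x0 <= x <= x1)%R -> (Cmod (h (x, y)) <= M)%R) ->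
      (Cmod (CInt (fun x => g (x, y)) x0 x1) <= w * (M * / Cmod h0 * exp (- L)))%R).
    { intros y M Hy HMy. rewrite Ew. apply CInt_norm_le; [lra | |].
      - eapply ex_CInt_horizontal; [exact Hg | destruct Hy; lra ..].
      - intros x Hx. unfold g. rewrite Cmod_mult, Cmod_div, Cmod_Cexp by assumption.
        assert (0 < Cmod h0)%R by (apply Cmod_gt_0; assumption).
        apply Rmult_le_compat; [| left; apply exp_pos | |].
        + apply Rmult_le_pos; [apply Cmod_ge_0 |]. left. now apply Rinv_0_lt_compat.
        + apply Rmult_le_compat_r; [left; now apply Rinv_0_lt_compat | now apply HMy].
        + apply exp_le. rewrite re_scal_l, re_mult. unfold z0; simpl.
          assert ((x + - x0) * (x + - x0) - (y + - y0) * (y + - y0) <= - 1)%R.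
          { rewrite Er, Ew in Hy. destruct Hy as [-> | ->]; nra. }
          nra. }
    assert (HIm : (Cmod I <= A * exp (- L))%R).
    { rewrite HI, Cmod_mult, Cmod_Ci, Rmult_1_l. unfold Cminus.
      eapply Rle_trans; [apply Cmod_triangle |]. rewrite Cmod_opp.
      pose proof (Hside _ _ (or_introl eq_refl) HM1). pose proof (Hside _ _ (or_intror eq_refl) HM2).
      fold I1 in H. fold I2 in H0. unfold A. nra. }
    eapply Rle_trans; [| exact HIm].
    eapply Rle_trans; [| apply re_le_Cmod]. eapply Rle_trans; [| apply Rle_abs].
    right. unfold I. rewrite Re_CInt.
    + apply RInt_ext. intros y _. unfold g.
      replace (Cexp (L * (((x0, y) - z0) * ((x0, y) - z0)))) with (RtoC (exp (- L * (y - y0) ^ 2))).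
      { now rewrite re_scal_r. }
      apply C_eq.
      * rewrite Re_Cexp. rewrite !re_scal_l, !im_scal_l. unfold z0; simpl.
        match goal with |- context [cos ?u] => replace u with 0%R by ring end.
        rewrite cos_0, (Rmult_1_r (exp _)). f_equal. ring.
      * rewrite Im_Cexp. rewrite !re_scal_l, !im_scal_l. unfold z0; simpl.
        match goal with |- context [sin ?u] => replace u with 0%R by ring end.
        rewrite sin_0. ring.
    + eapply ex_CInt_vertical; [exact Hg | lra ..].
Qed.

(** * Blocks of the weighted double sum *)

Fixpoint csum (f : nat -> C) (n : nat) : C :=
  match n with O => 0 | S k => csum f k + f (S k) end.

Lemma csum_ext (f g : nat -> C) (n : nat) :
  (forall i, (1 <= i <= n)%nat -> f i = g i) -> csum f n = csum g n.
Proof.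
  induction n as [| n IH]; intros H; simpl; [reflexivity |].
  rewrite IH, H; [reflexivity | lia | intros i Hi; apply H; lia].
Qed.

Lemma csum_plus (f g : nat -> C) (n : nat) :
  csum (fun i => f i + g i) n = csum f n + csum g n.
Proof. induction n as [| n IH]; simpl; [ring |]. rewrite IH. ring. Qed.

Lemma csum_scal (k : C) (f : nat -> C) (n : nat) :
  csum (fun i => k * f i) n = k * csum f n.
Proof. induction n as [| n IH]; simpl; [ring |]. rewrite IH. ring. Qed.

Lemma csum_app (f : nat -> C) (m n : nat) :
  csum f (m + n) = csum f m + csum (fun i => f (m + i)%nat) n.
Proof.
  induction n as [| n IH]; simpl; [rewrite Nat.add_0_r; ring |].
  rewrite Nat.add_succ_r. simpl. rewrite IH. ring.
Qed.

Lemma csum_bound (f : nat -> C) (n : nat) (M : R) :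
  (forall i, (1 <= i <= n)%nat -> (Cmod (f i) <= M)%R) -> (Cmod (csum f n) <= INR n * M)%R.
Proof.
  induction n as [| n IH]; intros H.
  - simpl. rewrite Cmod_0. lra.
  - rewrite S_INR. simpl csum. eapply Rle_trans; [apply Cmod_triangle |].
    specialize (IH ltac:(intros i Hi; apply H; lia)). specialize (H (S n) ltac:(lia)). lra.
Qed.

Lemma a_below (c i : nat) : (1 <= i < c)%nat -> a c i = 1.
Proof. intros H. unfold a. rewrite Nat.mod_small by lia. destruct (Nat.eqb_spec i 0); [lia | reflexivity]. Qed.

Lemma a_self (c : nat) : (1 <= c)%nat -> a c c = 1 - RtoC (INR c).
Proof. intros H. unfold a. rewrite Nat.Div0.mod_same. reflexivity. Qed.

Lemma a_shift (c k n : nat) : a c (c * k + n) = a c n.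
Proof. unfold a. rewrite Nat.add_comm, (Nat.mul_comm c k), Nat.Div0.mod_add. reflexivity. Qed.

Lemma Cmod_a_le (c n : nat) : (1 <= c)%nat -> (Cmod (a c n) <= INR c)%R.
Proof.
  intros H. assert (1 <= INR c)%R by (apply (le_INR 1); lia).
  unfold a. destruct (Nat.eqb _ _).
  - rewrite <- RtoC_minus, Cmod_R. apply Rabs_le. lra.
  - rewrite Cmod_1. assumption.
Qed.

Lemma csum_a (c : nat) (g : nat -> C) : (1 <= c)%nat ->
  csum (fun i => a c i * g i) c = csum g c - RtoC (INR c) * g c.
Proof.
  intros Hc. destruct c as [| c]; [lia |].
  simpl csum. rewrite a_self by lia.
  rewrite (csum_ext _ g c). { ring. }
  intros i Hi. rewrite a_below by lia. ring.
Qed.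

Lemma csum_const (k : C) (n : nat) : csum (fun _ => k) n = RtoC (INR n) * k.
Proof.
  induction n as [| n IH]; [simpl; ring |]. rewrite S_INR, RtoC_plus. simpl csum. rewrite IH. ring.
Qed.

Lemma csum_a_0 (c : nat) : (1 <= c)%nat -> csum (a c) c = 0.
Proof.
  intros Hc. rewrite (csum_ext _ (fun i => a c i * 1)) by (intros; ring).
  rewrite csum_a by assumption. rewrite csum_const. ring.
Qed.

Definition double_sum (c : nat) (g : nat -> C) (N : nat) : C :=
  csum (fun n => csum (fun i => a c n * a c i * g (n + i)%nat) c) N.

Lemma double_sum_ext (c : nat) (f g : nat -> C) (N : nat) :
  (forall m, (2 <= m <= N + c)%nat -> f m = g m) -> double_sum c f N = double_sum c g N.
Proof.
  intros H. apply csum_ext. intros n Hn. apply csum_ext. intros i Hi. rewrite H by lia. reflexivity.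
Qed.

Lemma double_sum_plus (c : nat) (f g : nat -> C) (N : nat) :
  double_sum c (fun m => f m + g m) N = double_sum c f N + double_sum c g N.
Proof.
  unfold double_sum. rewrite <- csum_plus. apply csum_ext. intros n _.
  rewrite <- csum_plus. apply csum_ext. intros i _. ring.
Qed.

Lemma double_sum_scal (c : nat) (k : C) (f : nat -> C) (N : nat) :
  double_sum c (fun m => k * f m) N = k * double_sum c f N.
Proof.
  unfold double_sum. rewrite <- csum_scal. apply csum_ext. intros n _.
  rewrite <- csum_scal. apply csum_ext. intros i _. ring.
Qed.

Lemma double_sum_succ (c : nat) (g : nat -> C) (N : nat) :
  double_sum c g (c * S N) = double_sum c g (c * N) + double_sum c (fun m => g (c * N + m)%nat) c.
Proof.
  unfold double_sum. replace (c * S N)%nat with (c * N + c)%nat by lia.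
  rewrite csum_app. f_equal. apply csum_ext. intros n _. apply csum_ext. intros i _.
  rewrite a_shift. rewrite Nat.add_assoc. reflexivity.
Qed.

(** Both weights have mean zero over a period, so the sum over i removes the part
    that depends on n alone, and the sum over n the rest. *)
Lemma double_sum_affine (c : nat) (p q : C) : (1 <= c)%nat ->
  double_sum c (fun m => p + RtoC (INR m) * q) c = 0.
Proof.
  intros Hc. unfold double_sum.
  set (I := csum (fun i => a c i * RtoC (INR i)) c).
  rewrite (csum_ext _ (fun n => (q * I) * a c n)).
  { rewrite csum_scal, csum_a_0 by assumption. ring. }
  intros n _.
  rewrite (csum_ext _ (fun i => (a c n * (p + RtoC (INR n) * q)) * a c i + (a c n * q) * (a c i * RtoC (INR i)))).
  { rewrite csum_plus, !csum_scal, csum_a_0 by assumption. fold I. ring. }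
  intros i _. rewrite plus_INR, RtoC_plus. ring.
Qed.

Lemma double_sum_bound (c : nat) (g : nat -> C) (M : R) : (1 <= c)%nat ->
  (forall m, (2 <= m <= 2 * c)%nat -> (Cmod (g m) <= M)%R) ->
  (Cmod (double_sum c g c) <= INR c ^ 4 * M)%R.
Proof.
  intros Hc HM.
  assert (0 <= M)%R by (eapply Rle_trans; [apply Cmod_ge_0 | apply (HM 2%nat); lia]).
  assert (Hc1 : (1 <= INR c)%R) by (apply (le_INR 1); lia).
  replace (INR c ^ 4 * M)%R with (INR c * (INR c * (INR c * INR c * M)))%R by ring.
  apply csum_bound. intros n Hn. apply csum_bound. intros i Hi.
  rewrite !Cmod_mult.
  pose proof (Cmod_a_le c n Hc). pose proof (Cmod_a_le c i Hc).
  pose proof (Cmod_ge_0 (a c n)). pose proof (Cmod_ge_0 (a c i)).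
  apply Rmult_le_compat; [nra | apply Cmod_ge_0 | | apply HM; lia].
  apply Rmult_le_compat; assumption.
Qed.

Lemma is_derive_RC_taylor2 (f f1 f2 : R -> C) (x0 x M : R) :
  (x0 <= x)%R ->
  (forall t, (x0 <= t <= x)%R -> is_derive_RC f t (f1 t)) ->
  (forall t, (x0 <= t <= x)%R -> is_derive_RC f1 t (f2 t)) ->
  (forall t, (x0 <= t <= x)%R -> (Cmod (f2 t) <= M)%R) ->
  (Cmod (f x - f x0 - RtoC (x - x0) * f1 x0) <= M * (x - x0) ^ 2)%R.
Proof.
  intros Hx H1 H2 HM.
  replace (f x - f x0 - RtoC (x - x0) * f1 x0) with
    ((f x + RtoC x * - f1 x0) - (f x0 + RtoC x0 * - f1 x0)) by (rewrite RtoC_minus; ring).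
  replace (M * (x - x0) ^ 2)%R with (M * (x - x0) * (x - x0))%R by ring.
  assert (0 <= M)%R by (eapply Rle_trans; [apply Cmod_ge_0 | apply (HM x0); lra]).
  apply (is_derive_RC_mvt (fun t => f t + RtoC t * - f1 x0) (fun t => f1 t - f1 x0)); [assumption | |].
  - intros t Ht. eapply is_derive_RC_eq.
    + apply is_derive_RC_plus; [apply H1, Ht |].
      apply (is_derive_RC_mult RtoC (fun _ => - f1 x0)); [| apply is_derive_RC_const].
      apply is_derive_RC_id.
    + ring.
  - intros t Ht. eapply Rle_trans; [apply (is_derive_RC_mvt f1 f2 x0 t M) |].
    + lra.
    + intros u Hu. apply H2. lra.
    + intros u Hu. apply HM. lra.
    + apply Rmult_le_compat_l; lra.
Qed.

(** x^w P(log x).  The class is stable under d/dx, which maps (w, P) to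
    (w - 1, w P + P'); it contains x^(-s), its derivatives in s and their Taylor
    remainders. *)
Definition power_log (w : C) (P : R -> C) (x : R) : C := Cexp (RtoC (ln x) * w) * P (ln x).

Lemma is_derive_power_log (w : C) (P : R -> C) (x : R) (dP : C) :
  (0 < x)%R -> is_derive_RC P (ln x) dP ->
  is_derive_RC (power_log w P) x (Cexp (RtoC (ln x) * (w - 1)) * (w * P (ln x) + dP)).
Proof.
  intros Hx HP.
  assert (Hln : is_derive ln x (/ x)%R) by (auto_derive; [assumption | field; lra]).
  assert (Hinv : RtoC (/ x) = Cexp (RtoC (ln x) * - 1)).
  { apply C_eq.
    - rewrite Re_Cexp, re_scal_l, im_scal_l.
      replace (Re (- 1)) with (- 1)%R by reflexivity. replace (Im (- 1)) with 0%R by (simpl; ring).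
      rewrite Rmult_0_r, cos_0, Rmult_1_r.
      replace (ln x * - 1)%R with (- ln x)%R by ring. rewrite exp_Ropp, exp_ln by assumption. reflexivity.
    - rewrite Im_Cexp, im_scal_l. replace (Im (- 1)) with 0%R by (simpl; ring).
      rewrite Rmult_0_r, sin_0, Rmult_0_r. reflexivity. }
  eapply is_derive_RC_eq.
  - unfold power_log. apply (is_derive_RC_comp (fun t => Cexp (RtoC t * w) * P t) ln); [| exact Hln].
    apply is_derive_RC_mult; [apply is_derive_RC_Cexp | exact HP].
  - replace (RtoC (ln x) * (w - 1)) with (RtoC (ln x) * - 1 + RtoC (ln x) * w) by ring.
    rewrite Cexp_plus, Hinv. ring.
Qed.

Definition decay (q : R) (k : nat) : R := exp (- (1 + q) * ln (INR k + 1)).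

(** INR c ^ 4 accounts for c^2 products of two weights of modulus at most c, 2c
    bounds the distance of a node from the base point, and the last factor comes
    from differentiating x^w P(log x) twice. *)
Definition block_const (c : nat) (w : C) : R :=
  (INR c ^ 4 * (2 * INR c) ^ 2 * ((Cmod w + 1) * (Cmod w + 2)))%R.

Lemma ln_nonneg (x : R) : (1 <= x)%R -> (0 <= ln x)%R.
Proof. intros H. rewrite <- ln_1. destruct H as [H | <-]; [left; apply ln_increasing; lra | lra]. Qed.

(** P is tested only at t = log x with x >= 1, where exp(q t) = x^q. *)
Definition log_profile (K q : R) (P : R -> C) : Prop :=
  exists P1 P2 : R -> C, forall t : R, (0 <= t)%R ->
    is_derive_RC P t (P1 t) /\ is_derive_RC P1 t (P2 t) /\
    (Cmod (P t) <= K * exp (q * t))%R /\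
    (Cmod (P1 t) <= K * exp (q * t))%R /\
    (Cmod (P2 t) <= K * exp (q * t))%R.

(** Subtract from x^w P(log x) its first-order Taylor polynomial at the left end of
    the block, which the block annihilates.  The second derivative is of size
    x^(Re w - 2 + q), and Re w = 1 - 2q makes this exponent equal to -(1 + q). *)
Lemma block_bound (c : nat) (w : C) (P : R -> C) (K q : R) (k : nat) :
  (1 <= c)%nat -> (0 < q)%R -> Re w = (1 - 2 * q)%R -> log_profile K q P ->
  (Cmod (double_sum c (fun m => power_log w P (INR (c * k + m))) c)
    <= block_const c w * K * decay q k)%R.
Proof.
  intros Hc Hq Hw [P1 [P2 HP]].
  assert (HK : (0 <= K)%R).
  { destruct (HP 0%R (Rle_refl _)) as [_ [_ [B _]]].
    rewrite Rmult_0_r, exp_0 in B. pose proof (Cmod_ge_0 (P 0%R)). lra. }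
  assert (Hc1 : (1 <= INR c)%R) by (apply (le_INR 1); lia).
  (* The nodes are ck+2, ..., ck+2c; starting at ck+1 rather than ck keeps x0 >= 1 when k = 0. *)
  set (x0 := (INR (c * k) + 1)%R).
  pose proof (pos_INR k) as Hk0.
  assert (Hx0 : (INR k + 1 <= x0)%R) by (unfold x0; rewrite mult_INR; nra).
  set (G1 := fun x => Cexp (RtoC (ln x) * (w - 1)) * (w * P (ln x) + P1 (ln x))).
  set (G2 := fun x => Cexp (RtoC (ln x) * (w - 1 - 1)) *
    ((w - 1) * (w * P (ln x) + P1 (ln x)) + (w * P1 (ln x) + P2 (ln x)))).
  set (W := ((Cmod w + 1) * (Cmod w + 2))%R).
  assert (HW : (0 <= W)%R) by (unfold W; pose proof (Cmod_ge_0 w); nra).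
  set (M := (W * K * decay q k)%R).
  assert (D1 : forall x, (x0 <= x)%R -> is_derive_RC (power_log w P) x (G1 x)).
  { intros x Hx. apply is_derive_power_log; [lra |]. apply HP, ln_nonneg. lra. }
  assert (D2 : forall x, (x0 <= x)%R -> is_derive_RC G1 x (G2 x)).
  { intros x Hx. assert (0 <= ln x)%R by (apply ln_nonneg; lra).
    apply (is_derive_power_log (w - 1) (fun t => w * P t + P1 t)); [lra |].
    eapply is_derive_RC_eq.
    - apply is_derive_RC_plus; [| apply HP; assumption].
      apply (is_derive_RC_mult (fun _ => w) P); [apply is_derive_RC_const | apply HP; assumption].
    - ring. }
  assert (D3 : forall x, (x0 <= x)%R -> (Cmod (G2 x) <= M)%R).
  { intros x Hx. assert (Hl : (0 <= ln x)%R) by (apply ln_nonneg; lra).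
    unfold G2. rewrite Cmod_mult, Cmod_Cexp.
    set (e := exp (q * ln x)).
    assert (Hp : (Cmod ((w - 1) * (w * P (ln x) + P1 (ln x)) + (w * P1 (ln x) + P2 (ln x))) <= W * (K * e))%R).
    { destruct (HP _ Hl) as [_ [_ [B [B1 B2]]]]. fold e in B, B1, B2.
      set (T := (K * e)%R) in *.
      pose proof (Cmod_ge_0 w). pose proof (Cmod_ge_0 (P (ln x))). pose proof (Cmod_ge_0 (P1 (ln x))).
      assert (Hw1 : (Cmod (w - 1) <= Cmod w + 1)%R).
      { unfold Cminus. eapply Rle_trans; [apply Cmod_triangle |]. rewrite Cmod_opp, Cmod_1. lra. }
      assert (E1 : (Cmod (w * P (ln x) + P1 (ln x)) <= Cmod w * T + T)%R).
      { eapply Rle_trans; [apply Cmod_triangle |]. rewrite Cmod_mult. nra. }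
      assert (E2 : (Cmod (w * P1 (ln x) + P2 (ln x)) <= Cmod w * T + T)%R).
      { eapply Rle_trans; [apply Cmod_triangle |]. rewrite Cmod_mult. nra. }
      eapply Rle_trans; [apply Cmod_triangle |]. rewrite Cmod_mult.
      assert (E3 : (Cmod (w - 1) * Cmod (w * P (ln x) + P1 (ln x)) <= (Cmod w + 1) * (Cmod w * T + T))%R).
      { apply Rmult_le_compat; auto using Cmod_ge_0. }
      unfold W. nra. }
    assert (Hexp : (exp (Re (RtoC (ln x) * (w - 1 - 1))) * e <= decay q k)%R).
    { unfold e, decay. rewrite <- exp_plus. apply exp_le.
      rewrite re_scal_l. replace (Re (w - 1 - 1)) with (Re w - 2)%R by (simpl; unfold Re; ring).
      replace (ln x * (Re w - 2) + q * ln x)%R with (- (1 + q) * ln x)%R by (rewrite Hw; ring).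
      assert (ln (INR k + 1) <= ln x)%R by (apply ln_le; lra). nra. }
    eapply Rle_trans; [apply Rmult_le_compat_l; [left; apply exp_pos | exact Hp] |].
    unfold M. assert (0 <= W * K)%R by nra. nra. }
  set (G := power_log w P) in *.
  rewrite (double_sum_ext _ _ (fun m => (G (INR (c * k + m)) - G x0 - RtoC (INR (c * k + m) - x0) * G1 x0)
     + ((G x0 - G1 x0) + RtoC (INR m) * G1 x0))).
  2: { intros m _. unfold x0. rewrite plus_INR.
       replace (INR (c * k) + INR m - (INR (c * k) + 1))%R with (INR m - 1)%R by ring.
       rewrite RtoC_minus. ring. }
  rewrite double_sum_plus, double_sum_affine, Cplus_0_r by assumption.
  replace (block_const c w * K * decay q k)%R with (INR c ^ 4 * (M * (2 * INR c) ^ 2))%R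
    by (unfold block_const, M, W; ring).
  apply double_sum_bound; [assumption |]. intros m Hm.
  assert (Hmx : (INR (c * k + m) - x0 = INR m - 1)%R) by (unfold x0; rewrite plus_INR; ring).
  assert (Hm1 : (2 <= INR m)%R) by (apply (le_INR 2); lia).
  assert (Hm2 : (INR m <= 2 * INR c)%R).
  { replace (2 * INR c)%R with (INR (2 * c)) by (rewrite mult_INR; simpl; ring). apply le_INR; lia. }
  eapply Rle_trans; [apply (is_derive_RC_taylor2 G G1 G2 x0 _ M) |].
  - lra.
  - intros t Ht. apply D1. lra.
  - intros t Ht. apply D2. lra.
  - intros t Ht. apply D3. lra.
  - apply Rmult_le_compat_l.
    + eapply Rle_trans; [apply Cmod_ge_0 | apply (D3 x0); lra].
    + apply pow_incr. lra.
Qed.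

(** By the mean value theorem (k+2)^(-1-q) is at most
    ((k+1)^(-q) - (k+2)^(-q)) / q, and these differences telescope. *)
Lemma ex_series_decay (q : R) : (0 < q)%R -> ex_series (decay q).
Proof.
  intros Hq. apply ex_series_incr_1.
  set (u := fun k : nat => exp (- q * ln (INR k + 1))).
  assert (Hu : forall k, (decay q (S k) <= / q * (u k - u (S k)))%R).
  { intros k. pose proof (pos_INR k) as Hk.
    destruct (MVT_gen (fun x => exp (- q * ln x)) (INR k + 1) (INR (S k) + 1)
      (fun x => - q * / x * exp (- q * ln x))%R) as [x [Hx E]].
    - rewrite S_INR, Rmin_left, Rmax_right by lra. intros x Hx. auto_derive; [lra |]. field. lra.
    - rewrite S_INR, Rmin_left, Rmax_right by lra. intros x Hx. apply continuity_pt_filterlim.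
      apply (ex_derive_continuous (fun x => exp (- q * ln x))). auto_derive. lra.
    - rewrite S_INR, Rmin_left, Rmax_right in Hx by lra.
      fold (u k) in E. change (exp (- q * ln (INR (S k) + 1))) with (u (S k)) in E.
      assert (E2 : (u k - u (S k) = q * (/ x * exp (- q * ln x)))%R).
      { replace (INR (S k) + 1 - (INR k + 1))%R with 1%R in E by (rewrite S_INR; ring). lra. }
      rewrite E2. rewrite <- Rmult_assoc, Rinv_l, Rmult_1_l by lra.
      unfold decay. rewrite S_INR.
      replace (/ x)%R with (exp (- ln x)) by (rewrite exp_Ropp, exp_ln by lra; reflexivity).
      rewrite <- exp_plus. apply exp_le.
      assert (ln x <= ln (INR k + 1 + 1))%R by (apply ln_le; lra). nra. }
  assert (Hsum : forall n, (sum_n (fun k => decay q (S k)) n <= / q * (u O - u (S n)))%R).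
  { induction n as [| n IH].
    - rewrite sum_O. apply Hu.
    - rewrite sum_Sn. change plus with Rplus. specialize (Hu (S n)). lra. }
  assert (Hex : ex_finite_lim_seq (sum_n (fun k => decay q (S k)))).
  { apply (ex_finite_lim_seq_incr _ (/ q * u O)).
    - intros n. rewrite sum_Sn. change plus with Rplus. unfold decay at 3.
      pose proof (exp_pos (- (1 + q) * ln (INR (S (S n)) + 1))). lra.
    - intros n. eapply Rle_trans; [apply Hsum |]. apply Rmult_le_compat_l.
      + left. now apply Rinv_0_lt_compat.
      + unfold u. pose proof (exp_pos (- q * ln (INR (S n) + 1))). lra. }
  destruct Hex as [l Hl]. exists l. exact Hl.
Qed.

(** * Limits of complex sequences *)

Definition Ccv (S : nat -> C) (l : C) : Prop :=
  forall eps : R, (0 < eps)%R -> exists N, forall n, (N <= n)%nat -> (Cmod (S n - l) < eps)%R.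

Lemma Ccv_filterlim (S : nat -> C) (l : C) :
  Ccv S l <-> filterlim S eventually (locally l).
Proof.
  split.
  - intros H. apply filterlim_locally. intros eps.
    destruct (H eps (cond_pos eps)) as [N HN]. exists N. intros n Hn.
    apply C_NormedModule_mixin_compat1. exact (HN n Hn).
  - intros H eps Heps.
    assert (Hs : (0 < sqrt 2)%R) by (apply sqrt_lt_R0; lra).
    assert (He : (0 < eps / sqrt 2)%R) by (apply Rdiv_lt_0_compat; assumption).
    destruct (proj1 (filterlim_locally S l) H (mkposreal _ He)) as [N HN].
    exists N. intros n Hn. specialize (HN n Hn).
    apply (C_NormedModule_mixin_compat2 l (S n) (mkposreal _ He)) in HN.
    simpl in HN. replace (sqrt 2 * (eps / sqrt 2))%R with eps in HN by (field; lra). exact HN.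
Qed.

Lemma Ccv_ext (S T : nat -> C) (l : C) : (forall n, S n = T n) -> Ccv S l -> Ccv T l.
Proof. intros E H eps He. destruct (H eps He) as [N HN]. exists N. intros n Hn. rewrite <- E. auto. Qed.

Lemma Ccv_const (k : C) : Ccv (fun _ => k) k.
Proof. intros eps He. exists O. intros n _. replace (k - k) with (RtoC 0) by ring. rewrite Cmod_0. assumption. Qed.

Lemma Ccv_plus (S T : nat -> C) (l m : C) : Ccv S l -> Ccv T m -> Ccv (fun n => S n + T n) (l + m).
Proof.
  intros HS HT eps He.
  destruct (HS (eps / 2)%R ltac:(lra)) as [N HN]. destruct (HT (eps / 2)%R ltac:(lra)) as [M HM].
  exists (N + M)%nat. intros n Hn. specialize (HN n ltac:(lia)). specialize (HM n ltac:(lia)).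
  replace (S n + T n - (l + m)) with ((S n - l) + (T n - m)) by ring.
  eapply Rle_lt_trans; [apply Cmod_triangle |]. lra.
Qed.

Lemma Ccv_scal (k : C) (S : nat -> C) (l : C) : Ccv S l -> Ccv (fun n => k * S n) (k * l).
Proof.
  intros HS eps He. pose proof (Cmod_ge_0 k) as Hk.
  assert (He' : (0 < eps / (Cmod k + 1))%R) by (apply Rdiv_lt_0_compat; lra).
  destruct (HS _ He') as [N HN].
  exists N. intros n Hn. specialize (HN n Hn).
  replace (k * S n - k * l) with (k * (S n - l)) by ring. rewrite Cmod_mult.
  pose proof (Cmod_ge_0 (S n - l)).
  apply Rle_lt_trans with ((Cmod k + 1) * Cmod (S n - l))%R; [nra |].
  replace eps with ((Cmod k + 1) * (eps / (Cmod k + 1)))%R by (field; lra).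
  apply Rmult_lt_compat_l; lra.
Qed.

Lemma Ccv_subseq (S : nat -> C) (l : C) (phi : nat -> nat) :
  (forall n, (n <= phi n)%nat) -> Ccv S l -> Ccv (fun n => S (phi n)) l.
Proof.
  intros Hphi H eps He. destruct (H eps He) as [N HN]. exists N. intros n Hn. apply HN.
  specialize (Hphi n). lia.
Qed.

Lemma Ccv_csum (S : nat -> nat -> C) (l : nat -> C) (n : nat) :
  (forall i, Ccv (S i) (l i)) -> Ccv (fun N => csum (fun i => S i N) n) (csum l n).
Proof.
  intros H. induction n as [| n IH]; simpl; [apply Ccv_const |]. now apply Ccv_plus.
Qed.

Lemma Ccv_bound (S : nat -> C) (l : C) (B : R) :
  (forall n, (Cmod (S n) <= B)%R) -> Ccv S l -> (Cmod l <= B)%R.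
Proof.
  intros HB H. apply le_epsilon. intros eps He. destruct (H eps He) as [N HN].
  specialize (HN N (le_n N)). specialize (HB N).
  replace l with (S N + - (S N - l)) by ring.
  eapply Rle_trans; [apply Cmod_triangle |]. rewrite Cmod_opp. lra.
Qed.

Lemma Ccv_unique (S : nat -> C) (l m : C) : Ccv S l -> Ccv S m -> l = m.
Proof.
  intros Hl Hm.
  assert (H : Ccv (fun n => S n + (- 1) * S n) (l + (- 1) * m)) by (apply Ccv_plus; [| apply Ccv_scal]; assumption).
  apply Ceq_minus. apply Cmod_eq_0. apply Rle_antisym; [| apply Cmod_ge_0].
  replace (l - m) with (l + (- 1) * m) by ring.
  apply (Ccv_bound _ _ 0 ) in H; [exact H |]. intros n.
  replace (S n + (- 1) * S n) with (RtoC 0) by ring. rewrite Cmod_0. lra.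
Qed.

Definition Clim (S : nat -> C) : C :=
  (real (Lim_seq (fun n => Re (S n))), real (Lim_seq (fun n => Im (S n)))).

Lemma Clim_correct (S : nat -> C) (l : C) : Ccv S l -> Clim S = l.
Proof.
  intros H. unfold Clim. destruct l as [x y]. f_equal.
  - rewrite (is_lim_seq_unique _ x); [reflexivity |]. apply is_lim_seq_spec. intros eps.
    destruct (H eps (cond_pos eps)) as [N HN]. exists N. intros n Hn.
    eapply Rle_lt_trans; [| apply (HN n Hn)]. exact (re_le_Cmod (S n - (x, y))).
  - rewrite (is_lim_seq_unique _ y); [reflexivity |]. apply is_lim_seq_spec. intros eps.
    destruct (H eps (cond_pos eps)) as [N HN]. exists N. intros n Hn.
    eapply Rle_lt_trans; [| apply (HN n Hn)]. exact (im_le_Cmod (S n - (x, y))).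
Qed.

Lemma Ccv_summable (u : nat -> C) (p : nat -> R) :
  u O = 0 -> (forall n, (Cmod (u (S n) - u n) <= p n)%R) -> ex_series p ->
  exists l, Ccv u l /\ (Cmod l <= Series p)%R.
Proof.
  intros Hu0 Hp Hex.
  assert (Hp0 : forall n, (0 <= p n)%R) by (intros n; eapply Rle_trans; [apply Cmod_ge_0 | apply Hp]).
  destruct (ex_series_le (V := C_CompleteNormedModule) (fun n => u (S n) - u n) p Hp Hex) as [l Hl].
  assert (Hsum : forall n, sum_n (G := C_AbelianMonoid) (fun n => u (S n) - u n) n = u (S n)).
  { induction n as [| n IH].
    - rewrite sum_O, Hu0. change (u 1%nat - 0 = u 1%nat). ring.
    - rewrite sum_Sn, IH. change (u (S n) + (u (S (S n)) - u (S n)) = u (S (S n))). ring. }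
  assert (Hcv : Ccv u l).
  { intros eps He.
    assert (Hc : Ccv (fun n => u (S n)) l).
    { apply Ccv_filterlim. eapply filterlim_ext; [exact Hsum | exact Hl]. }
    destruct (Hc eps He) as [N HN]. exists (S N). intros [| n] Hn; [lia |]. apply HN. lia. }
  exists l. split; [assumption |].
  apply (Ccv_bound u l); [| assumption].
  assert (Hpart : forall n, (Cmod (u (S n)) <= sum_n p n)%R).
  { induction n as [| n IH].
    - rewrite sum_O. specialize (Hp O). rewrite Hu0 in Hp. replace (u 1%nat - 0) with (u 1%nat) in Hp by ring. exact Hp.
    - rewrite sum_Sn. change plus with Rplus.
      replace (u (S (S n))) with (u (S n) + (u (S (S n)) - u (S n))) by ring.
      eapply Rle_trans; [apply Cmod_triangle |]. specialize (Hp (S n)). lra. }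
  assert (Hle : forall n, (sum_n p n <= Series p)%R).
  { intros n. apply (is_lim_seq_incr_compare (sum_n p) (Series p)).
    - exact (Series_correct p Hex).
    - intros k. rewrite sum_Sn. change plus with Rplus. specialize (Hp0 (S k)). lra. }
  intros [| n].
  - rewrite Hu0, Cmod_0. specialize (Hle O). rewrite sum_O in Hle. specialize (Hp0 O). lra.
  - eapply Rle_trans; [apply Hpart | apply Hle].
Qed.

(** * The regularized sum and its derivative *)

Lemma blocks_converge (c : nat) (w : C) (P : R -> C) (K q : R) :
  (1 <= c)%nat -> (0 < q)%R -> Re w = (1 - 2 * q)%R -> log_profile K q P ->
  exists l, Ccv (fun N => double_sum c (fun m => power_log w P (INR m)) (c * N)) l /\
    (Cmod l <= block_const c w * K * Series (decay q))%R.
Proof.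
  intros Hc Hq Hw HP.
  rewrite <- Series_scal_l. apply Ccv_summable.
  - rewrite Nat.mul_0_r. reflexivity.
  - intros n. rewrite double_sum_succ.
    match goal with |- (Cmod (?u + ?v - ?u) <= _)%R => replace (u + v - u) with v by ring end.
    exact (block_bound c w P K q n Hc Hq Hw HP).
  - apply (ex_series_scal_l (V := R_NormedModule)). now apply ex_series_decay.
Qed.

Definition negpow (s : C) (m : nat) : C := Cexp (RtoC (ln (INR m)) * - s).

Definition regularized_sum (c : nat) (s : C) : C := Clim (fun N => double_sum c (negpow s) (c * N)).

Lemma exp_sq_lower (u : R) : (0 <= u)%R -> (u ^ 2 <= 4 * exp u)%R.
Proof.
  intros Hu. replace u with (u / 2 + u / 2)%R at 2 by field. rewrite exp_plus.
  pose proof (exp_ineq1_le (u / 2)). nra.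
Qed.

(** Chosen so that 1, t and t^2 are all at most this constant times exp(q t / 2). *)
Definition profile_const (q : R) : R := (16 / q ^ 2 + 2 / q + 1)%R.

Lemma profile_const_bounds (q t : R) : (0 < q)%R -> (0 <= t)%R ->
  let B := (profile_const q * exp (q / 2 * t))%R in
  (1 <= B)%R /\ (t <= B)%R /\ (t ^ 2 <= B)%R.
Proof.
  intros Hq Ht B.
  assert (Hq2 : (0 < q ^ 2)%R) by (apply pow_lt; assumption).
  assert (H1 : (1 <= exp (q / 2 * t))%R) by (rewrite <- exp_0; apply exp_le; nra).
  assert (A1 : (0 < 16 / q ^ 2)%R) by (apply Rdiv_lt_0_compat; lra).
  assert (A2 : (0 < 2 / q)%R) by (apply Rdiv_lt_0_compat; lra).
  unfold B, profile_const. set (e := exp (q / 2 * t)) in *.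
  assert (B1 : (t <= 2 / q * e)%R).
  { pose proof (exp_ineq1_le (q / 2 * t)) as H. fold e in H.
    replace t with (2 / q * (q / 2 * t))%R by (field; lra). apply Rmult_le_compat_l; lra. }
  assert (B2 : (t ^ 2 <= 16 / q ^ 2 * e)%R).
  { pose proof (exp_sq_lower (q / 2 * t) ltac:(nra)) as H. fold e in H.
    replace (t ^ 2)%R with (4 / q ^ 2 * (q / 2 * t) ^ 2)%R by (field; lra).
    replace (16 / q ^ 2 * e)%R with (4 / q ^ 2 * (4 * e))%R by (field; lra).
    apply Rmult_le_compat_l; [| lra]. left. apply Rdiv_lt_0_compat; lra. }
  repeat split; nra.
Qed.

Lemma profile_const_pos (q : R) : (0 < q)%R -> (0 <= profile_const q)%R.
Proof.
  intros Hq. destruct (profile_const_bounds q 0%R Hq (Rle_refl _)) as [H _].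
  rewrite Rmult_0_r, exp_0 in H. lra.
Qed.

Lemma profile_weaken (q t x : R) : (0 < q)%R -> (0 <= t)%R ->
  (x <= profile_const q * exp (q / 2 * t))%R -> (x <= profile_const q * exp (q * t))%R.
Proof.
  intros Hq Ht H. eapply Rle_trans; [exact H |].
  apply Rmult_le_compat_l; [now apply profile_const_pos |]. apply exp_le. nra.
Qed.

Lemma log_profile_1 (q : R) : (0 < q)%R -> log_profile (profile_const q) q (fun _ => 1).
Proof.
  intros Hq. exists (fun _ => 0), (fun _ => 0). intros t Ht.
  assert (H0 : (0 <= profile_const q * exp (q * t))%R).
  { apply Rmult_le_pos; [now apply profile_const_pos | left; apply exp_pos]. }
  rewrite Cmod_1, Cmod_0.
  refine (conj (is_derive_RC_const _ _) (conj (is_derive_RC_const _ _) (conj _ (conj H0 H0)))).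
  apply profile_weaken; [assumption | assumption |]. now apply profile_const_bounds.
Qed.

Lemma log_profile_id (q : R) : (0 < q)%R -> log_profile (profile_const q) q RtoC.
Proof.
  intros Hq. exists (fun _ => 1), (fun _ => 0). intros t Ht.
  rewrite Cmod_1, Cmod_0, Cmod_R, Rabs_pos_eq by assumption.
  split; [apply is_derive_RC_id |]. split; [apply is_derive_RC_const |].
  repeat split.
  - apply profile_weaken; [assumption | assumption |]. now apply profile_const_bounds.
  - apply profile_weaken; [assumption | assumption |]. now apply profile_const_bounds.
  - apply Rmult_le_pos; [now apply profile_const_pos | left; apply exp_pos].
Qed.

(** This profile turns x^(-s) into the Taylor remainder
    x^(-s-h) - x^(-s) + h (log x) x^(-s).  The bound is quadratic in h. *)
Lemma log_profile_exp_remainder (q : R) (h : C) : (0 < q)%R -> (Cmod h <= q / 2)%R ->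
  log_profile (Cmod h ^ 2 * profile_const q) q
    (fun t => Cexp (RtoC t * - h) - 1 - RtoC t * - h).
Proof.
  intros Hq Hh. set (E := fun t => Cexp (RtoC t * - h)).
  pose proof (Cmod_ge_0 h) as Hh0. assert (Hh2 : (0 <= Cmod h ^ 2)%R) by apply pow2_ge_0.
  exists (fun t => - h * (E t - 1)), (fun t => h * h * E t). intros t Ht.
  assert (Hlin : Cmod (RtoC t * - h) = (t * Cmod h)%R).
  { rewrite Cmod_mult, Cmod_opp, Cmod_R, Rabs_pos_eq by assumption. reflexivity. }
  assert (Hexp : (exp (t * Cmod h) <= exp (q / 2 * t))%R) by (apply exp_le; nra).
  (* One factor exp (q t / 2) absorbs the power x of t, the other the growth of E. *)
  assert (Hstep : forall x y, (x <= profile_const q * exp (q / 2 * t))%R ->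
     (y <= Cmod h ^ 2 * x * exp (q / 2 * t))%R ->
     (y <= Cmod h ^ 2 * profile_const q * exp (q * t))%R).
  { intros x y Hx Hy. eapply Rle_trans; [exact Hy |].
    replace (q * t)%R with (q / 2 * t + q / 2 * t)%R by field. rewrite exp_plus.
    rewrite (Rmult_assoc (Cmod h ^ 2) (profile_const q)), <- (Rmult_assoc (profile_const q)), <- Rmult_assoc.
    apply Rmult_le_compat_r; [left; apply exp_pos |]. apply Rmult_le_compat_l; assumption. }
  destruct (profile_const_bounds q t Hq Ht) as [H0 [H1 H2]].
  split; [| split; [| split; [| split]]].
  - eapply is_derive_RC_eq.
    + apply (is_derive_RC_ext (fun t => E t + (- 1 + RtoC t * h))); [intros u; unfold E; ring |].
      apply is_derive_RC_plus; [apply is_derive_RC_Cexp |].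
      apply is_derive_RC_plus; [apply is_derive_RC_const |].
      apply (is_derive_RC_mult RtoC (fun _ => h)); [apply is_derive_RC_id | apply is_derive_RC_const].
    + unfold E. ring.
  - eapply is_derive_RC_eq.
    + apply (is_derive_RC_mult (fun _ => - h) (fun t => E t - 1)); [apply is_derive_RC_const |].
      apply (is_derive_RC_plus E (fun _ => Copp (RtoC 1))); [apply is_derive_RC_Cexp | apply is_derive_RC_const].
    + unfold E. ring.
  - apply (Hstep (t ^ 2)%R); [assumption |].
    eapply Rle_trans; [apply Cexp_taylor_bound |]. rewrite Hlin.
    replace (Cmod h ^ 2 * t ^ 2)%R with ((t * Cmod h) ^ 2)%R by ring.
    apply Rmult_le_compat_l; [apply pow2_ge_0 | assumption].
  - apply (Hstep t); [assumption |].
    rewrite Cmod_mult, Cmod_opp.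
    replace (Cmod h ^ 2 * t * exp (q / 2 * t))%R with (Cmod h * (t * Cmod h * exp (q / 2 * t)))%R by ring.
    apply Rmult_le_compat_l; [assumption |].
    eapply Rle_trans; [apply Cexp_sub1_bound |]. rewrite Hlin.
    apply Rmult_le_compat_l; [nra | assumption].
  - apply (Hstep 1%R); [assumption |].
    rewrite !Cmod_mult. unfold E. rewrite Cmod_Cexp.
    replace (Cmod h ^ 2 * 1 * exp (q / 2 * t))%R with (Cmod h * Cmod h * exp (q / 2 * t))%R by ring.
    apply Rmult_le_compat_l; [nra |]. eapply Rle_trans; [| exact Hexp].
    apply exp_le. rewrite <- Hlin.
    eapply Rle_trans; [apply Rle_abs | apply re_le_Cmod].
Qed.

(** The value of q for which Re (-s) = 1 - 2q; it is positive exactly when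
    Re s > -1. *)
Definition margin (s : C) : R := ((Re s + 1) / 2)%R.

Lemma margin_pos (s : C) : (-1 < Re s)%R -> (0 < margin s)%R.
Proof. unfold margin. lra. Qed.

Lemma margin_exponent (s : C) : Re (- s) = (1 - 2 * margin s)%R.
Proof. rewrite re_opp. unfold margin. field. Qed.

Lemma regularized_sum_cv (c : nat) (s : C) : (1 <= c)%nat -> (-1 < Re s)%R ->
  Ccv (fun N => double_sum c (negpow s) (c * N)) (regularized_sum c s).
Proof.
  intros Hc Hs. pose proof (margin_pos s Hs) as Hq.
  destruct (blocks_converge c (- s) (fun _ => 1) _ _ Hc Hq (margin_exponent s) (log_profile_1 _ Hq))
    as [l [Hl _]].
  assert (H : Ccv (fun N => double_sum c (negpow s) (c * N)) l).
  { eapply Ccv_ext; [| exact Hl]. intros n. apply double_sum_ext. intros m _.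
    unfold power_log, negpow. ring. }
  unfold regularized_sum. rewrite (Clim_correct _ _ H). exact H.
Qed.

Lemma log_sum_cv (c : nat) (s : C) : (1 <= c)%nat -> (-1 < Re s)%R ->
  exists D, Ccv (fun N => double_sum c (fun m => negpow s m * RtoC (ln (INR m))) (c * N)) D.
Proof.
  intros Hc Hs. pose proof (margin_pos s Hs) as Hq.
  destruct (blocks_converge c (- s) RtoC _ _ Hc Hq (margin_exponent s) (log_profile_id _ Hq))
    as [l [Hl _]].
  exists l. exact Hl.
Qed.

Lemma double_sum_remainder_cv (c : nat) (s h : C) :
  (1 <= c)%nat -> (-1 < Re s)%R -> (Cmod h <= margin s / 2)%R ->
  exists l,
    Ccv (fun N => double_sum c (fun m =>
      negpow (s + h) m - negpow s m + h * (negpow s m * RtoC (ln (INR m)))) (c * N)) l /\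
    (Cmod l <= block_const c (- s) * profile_const (margin s) * Series (decay (margin s)) * Cmod h ^ 2)%R.
Proof.
  intros Hc Hs Hh. pose proof (margin_pos s Hs) as Hq.
  destruct (blocks_converge c (- s) _ _ _ Hc Hq (margin_exponent s)
    (log_profile_exp_remainder _ h Hq Hh)) as [l [Hl Hb]].
  exists l. split.
  - eapply Ccv_ext; [| exact Hl]. intros n. apply double_sum_ext. intros m _.
    unfold power_log, negpow.
    replace (RtoC (ln (INR m)) * - (s + h)) with (RtoC (ln (INR m)) * - s + RtoC (ln (INR m)) * - h) by ring.
    rewrite Cexp_plus. ring.
  - eapply Rle_trans; [exact Hb |]. right. ring.
Qed.

(** The limit of the Taylor remainders is
    regularized_sum (s+h) - regularized_sum s + h D and is O(h^2). *)
Lemma is_derive_regularized_sum (c : nat) (s : C) : (1 <= c)%nat -> (-1 < Re s)%R ->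
  exists D, Ccv (fun N => double_sum c (fun m => negpow s m * RtoC (ln (INR m))) (c * N)) D /\
    is_derive (regularized_sum c) s (- D).
Proof.
  intros Hc Hs. destruct (log_sum_cv c s Hc Hs) as [D HD]. exists D. split; [assumption |].
  apply is_derive_C_iff. intros eps Heps.
  set (B := (block_const c (- s) * profile_const (margin s) * Series (decay (margin s)))%R).
  set (d := Rmin (margin s / 2) (eps / (Rabs B + 1))).
  pose proof (Rabs_pos B) as HB.
  exists d. split.
  { apply Rmin_pos; [pose proof (margin_pos s Hs); lra |]. apply Rdiv_lt_0_compat; lra. }
  intros w Hw. set (h := w - s) in *.
  assert (Hd1 : (Cmod h <= margin s / 2)%R).
  { pose proof (Rmin_l (margin s / 2) (eps / (Rabs B + 1))). unfold d in Hw. lra. }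
  assert (Hd2 : (Cmod h * (Rabs B + 1) <= eps)%R).
  { pose proof (Rmin_r (margin s / 2) (eps / (Rabs B + 1))).
    replace eps with (eps / (Rabs B + 1) * (Rabs B + 1))%R by (field; lra).
    apply Rmult_le_compat_r; [lra |]. unfold d in Hw. lra. }
  destruct (double_sum_remainder_cv c s h Hc Hs Hd1) as [l [Hl Hlb]].
  assert (Ew : w = s + h) by (unfold h; ring).
  assert (Hw1 : (-1 < Re w)%R).
  { rewrite Ew, re_plus. unfold margin in Hd1. pose proof (re_le_Cmod h). pose proof (Rle_abs (- Re h)). rewrite Rabs_Ropp in *. lra. }
  assert (El : l = regularized_sum c w - regularized_sum c s - h * - D).
  { eapply Ccv_unique; [exact Hl |].
    replace (regularized_sum c w - regularized_sum c s - h * - D) with (regularized_sum c w + ((- 1) * regularized_sum c s + h * D)) by ring.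
    apply (Ccv_ext (fun N => double_sum c (negpow w) (c * N) + ((- 1) * double_sum c (negpow s) (c * N)
      + h * double_sum c (fun m => negpow s m * RtoC (ln (INR m))) (c * N)))).
    - intros n. rewrite <- !double_sum_scal, <- !double_sum_plus. apply double_sum_ext. intros m _. rewrite Ew. ring.
    - apply Ccv_plus; [apply regularized_sum_cv; assumption |].
      apply Ccv_plus; apply Ccv_scal; [apply regularized_sum_cv |]; assumption. }
  rewrite <- El. eapply Rle_trans; [exact Hlb |]. fold B.
  pose proof (Cmod_ge_0 h). pose proof (Rle_abs B).
  replace (B * Cmod h ^ 2)%R with (B * Cmod h * Cmod h)%R by ring.
  apply Rmult_le_compat_r; [assumption |]. nra.
Qed.

(** * The double sum as partial Dirichlet sums *)

Lemma double_sum_block (c : nat) (g : nat -> C) : (1 <= c)%nat ->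
  double_sum c g c = csum (fun i => csum (fun n => g (i + n)%nat) c) c
    - 2 * RtoC (INR c) * csum (fun i => g (c + i)%nat) c
    + RtoC (INR c) ^ 2 * g (c + c)%nat.
Proof.
  intros Hc. unfold double_sum.
  rewrite (csum_ext _ (fun n => a c n * (csum (fun i => g (n + i)%nat) c - RtoC (INR c) * g (n + c)%nat))).
  2: { intros n _. rewrite (csum_ext _ (fun i => a c n * (a c i * g (n + i)%nat))) by (intros; ring).
       rewrite csum_scal, csum_a by assumption. reflexivity. }
  rewrite csum_a by assumption.
  rewrite (csum_ext _ (fun n => csum (fun i => g (n + i)%nat) c + - RtoC (INR c) * g (c + n)%nat)).
  2: { intros n _. rewrite (Nat.add_comm c n). ring. }
  rewrite csum_plus, csum_scal. ring.
Qed.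

(** Expand both weights as 1 - c [c | n].  The three terms are the sums with no,
    one and two factors carrying the indicator of multiples of c. *)
Lemma double_sum_closed_form (c : nat) (f : nat -> C) (N : nat) : (1 <= c)%nat ->
  double_sum c f (c * N) =
    csum (fun i => csum f (c * N + i) - csum f i) c
    - 2 * RtoC (INR c) * (csum f (c * N + c) - csum f c)
    + RtoC (INR c) ^ 2 * (csum (fun k => f (c * k)%nat) (S N) - f c).
Proof.
  intros Hc. induction N as [| N IH].
  - rewrite Nat.mul_0_r. simpl csum. rewrite Nat.mul_1_r.
    rewrite (csum_ext (fun i => csum f (0 + i) - csum f i) (fun _ => 0)) by (intros; simpl; ring).
    rewrite csum_const. unfold double_sum. simpl csum. ring.
  - rewrite double_sum_succ, IH, double_sum_block by assumption.
    rewrite (csum_ext (fun i => csum f (c * S N + i) - csum f i)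
      (fun i => (csum f (c * N + i) - csum f i) + csum (fun n => f (c * N + (i + n))%nat) c)).
    2: { intros i _. replace (c * S N + i)%nat with (c * N + i + c)%nat by lia. rewrite csum_app.
         rewrite (csum_ext (fun n => f (c * N + i + n)%nat) (fun n => f (c * N + (i + n))%nat)).
         - ring.
         - intros n _. f_equal. lia. }
    rewrite csum_plus.
    replace (csum f (c * S N + c)) with (csum f (c * N + c) + csum (fun i => f (c * N + (c + i))%nat) c).
    2: { replace (c * S N + c)%nat with (c * N + c + c)%nat by lia. rewrite (csum_app f (c * N + c) c). f_equal.
         apply csum_ext. intros n _. f_equal. lia. }
    simpl (csum _ (S (S N))). replace (c * S (S N))%nat with (c * N + (c + c))%nat by lia. simpl csum. ring.
Qed.

(** * Analytic continuation and the product formula *)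

Lemma negpow_npow (s : C) (m : nat) : negpow s m = / npow m s.
Proof. unfold negpow, npow. rewrite <- Cexp_opp. f_equal. ring. Qed.

Lemma npow_neq_0 (m : nat) (w : C) : npow m w <> 0.
Proof. apply Cexp_neq_0. Qed.

Lemma ln_INR_mult (c k : nat) : (1 <= c)%nat -> (1 <= k)%nat ->
  ln (INR (c * k)) = (ln (INR c) + ln (INR k))%R.
Proof.
  intros Hc Hk. rewrite mult_INR. apply ln_mult; apply lt_0_INR; lia.
Qed.

Lemma negpow_mult (s : C) (c k : nat) : (1 <= c)%nat -> (1 <= k)%nat ->
  negpow s (c * k) = negpow s c * negpow s k.
Proof.
  intros Hc Hk. unfold negpow. rewrite <- Cexp_plus, ln_INR_mult by assumption.
  rewrite RtoC_plus. f_equal. ring.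
Qed.

Lemma Cexp_ln_INR (c : nat) : (1 <= c)%nat -> Cexp (RtoC (ln (INR c))) = RtoC (INR c).
Proof.
  intros Hc. apply C_eq.
  - rewrite Re_Cexp. simpl. rewrite cos_0, exp_ln by (apply lt_0_INR; lia). ring.
  - rewrite Im_Cexp. simpl. rewrite sin_0. ring.
Qed.

Lemma csum_S (f : nat -> C) (n : nat) : csum f (S n) = csum f n + f (S n).
Proof. reflexivity. Qed.

Lemma csum_csum (f : nat -> C) (n : nat) :
  csum (csum f) n = csum (fun m => (RtoC (INR n) + 1 - RtoC (INR m)) * f m) n.
Proof.
  induction n as [| n IH]; [reflexivity |].
  rewrite (csum_S (csum f)), (csum_S _ n), IH, S_INR, RtoC_plus, csum_S.
  rewrite (csum_ext (fun m => (RtoC (INR n) + 1 + 1 - RtoC (INR m)) * f m)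
    (fun m => (RtoC (INR n) + 1 - RtoC (INR m)) * f m + f m)) by (intros; ring).
  rewrite csum_plus. rewrite S_INR, RtoC_plus. ring.
Qed.

(** The coefficient of f m is (c + m - 1) - c^2 [m = c]: the full convolution of the
    weights over a period is -c a_m, of which the double sum only sees the pairs
    n + i = m with n, i >= 1. *)
Definition boundary_terms (c : nat) (f : nat -> C) : C :=
  csum (fun m => (RtoC (INR c) + RtoC (INR m) - 1) * f m) c - RtoC (INR c) ^ 2 * f c.

(** The shifted partial sums all tend to zeta(s) and the sums over multiples of c to
    c^(-s) zeta(s); the terms in zeta(s) add up to
    -c (1 - c^(1-s)) zeta(s). *)
Lemma regularized_sum_eq_half_plane (zeta : C -> C) (c : nat) (zc : C -> C) (s : C) :
  is_riemann_zeta zeta -> (1 <= c)%nat -> is_zeta_c zeta c zc -> (1 < Re s)%R ->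
  regularized_sum c s = boundary_terms c (negpow s) - RtoC (INR c) * zc s.
Proof.
  intros [_ Hz] Hc [_ Hzc] Hs.
  specialize (Hz s Hs).
  assert (Hs1 : s <> 1) by (intros ->; simpl in Hs; lra).
  specialize (Hzc s Hs1). set (f := negpow s).
  assert (HT : Ccv (csum f) (zeta s)).
  { assert (Hsum : forall n, sum_n (fun n => 1 / npow (S n) s : C_NormedModule) n = csum f (S n)).
    { induction n as [| n IH].
      - rewrite sum_O. unfold f. simpl csum. rewrite negpow_npow. unfold Cdiv.
        change (1 * / npow 1 s = 0 + / npow 1 s). ring.
      - rewrite sum_Sn, IH, (csum_S f (S n)).
        change (csum f (S n) + 1 / npow (S (S n)) s = csum f (S n) + negpow s (S (S n))).
        rewrite negpow_npow. unfold Cdiv. ring. }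
    assert (H : Ccv (fun n => csum f (S n)) (zeta s)).
    { apply Ccv_filterlim. eapply filterlim_ext; [exact Hsum | exact Hz]. }
    intros eps He. destruct (H eps He) as [N HN]. exists (S N). intros [| n] Hn; [lia |]. apply HN. lia. }
  assert (HU : Ccv (fun N => csum (fun k => f (c * k)%nat) (S N)) (f c * zeta s)).
  { apply (Ccv_ext (fun N => f c * csum f (S N))).
    - intros N. rewrite <- csum_scal. apply csum_ext. intros k Hk. symmetry. apply negpow_mult; lia.
    - apply Ccv_scal. apply (Ccv_subseq _ _ S); [intros; lia | exact HT]. }
  assert (Hpow : RtoC (INR c) * f c = npow c (1 - s)).
  { unfold f, negpow, npow. rewrite <- (Cexp_ln_INR c) at 1 by assumption.
    rewrite <- Cexp_plus. f_equal. ring. }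
  apply Clim_correct.
  apply (Ccv_ext (fun N =>
    csum (fun i => csum f (c * N + i) + - csum f i) c
    + (- (2 * RtoC (INR c)) * (csum f (c * N + c) + - csum f c)
    + RtoC (INR c) ^ 2 * (csum (fun k => f (c * k)%nat) (S N) + - f c)))).
  { intros N. rewrite double_sum_closed_form by assumption. fold f. unfold Cminus. ring. }
  assert (Hshift : forall i, Ccv (fun N => csum f (c * N + i)) (zeta s)).
  { intros i. apply (Ccv_subseq _ _ (fun N => (c * N + i)%nat)); [intros; nia | exact HT]. }
  replace (boundary_terms c f - RtoC (INR c) * zc s) with
    (csum (fun i => zeta s + - csum f i) c
    + (- (2 * RtoC (INR c)) * (zeta s + - csum f c)
    + RtoC (INR c) ^ 2 * (f c * zeta s + - f c))).
  - apply Ccv_plus; [| apply Ccv_plus; apply Ccv_scal; apply Ccv_plus; auto using Ccv_const].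
    apply (Ccv_csum (fun i N => csum f (c * N + i) + - csum f i) (fun i => zeta s + - csum f i)).
    intros i. apply Ccv_plus; auto using Ccv_const.
  - rewrite Hzc, <- Hpow. unfold boundary_terms.
    rewrite (csum_ext (fun m => (RtoC (INR c) + RtoC (INR m) - 1) * f m)
      (fun m => 2 * RtoC (INR c) * f m + - (1) * ((RtoC (INR c) + 1 - RtoC (INR m)) * f m))) by (intros; ring).
    rewrite !csum_plus, !csum_scal, <- csum_csum, csum_const.
    rewrite (csum_ext (fun i => - csum f i) (fun i => - (1) * csum f i)) by (intros; ring).
    rewrite csum_scal. ring.
Qed.

Lemma is_derive_C_plus (f g : C -> C) (z l m : C) :
  is_derive f z l -> is_derive g z m -> is_derive (fun w => f w + g w) z (l + m).
Proof. apply (is_derive_plus (K := C_AbsRing) (V := C_NormedModule)). Qed.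

Lemma is_derive_C_eq (f : C -> C) (z l m : C) : is_derive f z l -> l = m -> is_derive f z m.
Proof. intros H <-. exact H. Qed.

Lemma is_derive_C_scal (k : C) (f : C -> C) (z l : C) :
  is_derive f z l -> is_derive (fun w => k * f w) z (k * l).
Proof.
  intros H. eapply is_derive_C_eq.
  - apply is_derive_C_mult; [apply is_derive_C_const | exact H].
  - cbv beta. ring.
Qed.

Lemma is_derive_C_csum (F : nat -> C -> C) (D : nat -> C) (z : C) (n : nat) :
  (forall m, is_derive (F m) z (D m)) ->
  is_derive (fun w => csum (fun m => F m w) n) z (csum D n).
Proof.
  intros H. induction n as [| n IH]; simpl; [apply is_derive_C_const |].
  apply is_derive_C_plus; auto.
Qed.

Lemma is_derive_negpow (m : nat) (s : C) :
  is_derive (fun w => negpow w m) s (- (negpow s m * RtoC (ln (INR m)))).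
Proof.
  unfold negpow. eapply is_derive_C_eq.
  - apply (is_derive_comp (K := C_AbsRing) (V := C_NormedModule) Cexp (fun w => RtoC (ln (INR m)) * - w)).
    + apply is_derive_Cexp.
    + apply is_derive_C_abs.
      apply (is_derive_ext (K := C_AbsRing) (V := C_NormedModule) (fun w : C => - RtoC (ln (INR m)) * w)).
      { intros w. change (- RtoC (ln (INR m)) * w = RtoC (ln (INR m)) * - w). ring. }
      apply is_derive_C_scal, is_derive_C_id.
  - change (- RtoC (ln (INR m)) * 1 * Cexp (RtoC (ln (INR m)) * - s) = - (Cexp (RtoC (ln (INR m)) * - s) * RtoC (ln (INR m)))). ring.
Qed.

Lemma is_derive_boundary_terms (c : nat) (s : C) :
  is_derive (fun w => boundary_terms c (negpow w)) s (boundary_terms c (fun m => - (negpow s m * RtoC (ln (INR m))))).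
Proof.
  unfold boundary_terms. eapply is_derive_C_eq.
  - apply (is_derive_ext (K := C_AbsRing) (V := C_NormedModule) (fun w =>
      csum (fun m => (RtoC (INR c) + RtoC (INR m) - 1) * negpow w m) c + - RtoC (INR c) ^ 2 * negpow w c)).
    { intros w. change (csum (fun m => (RtoC (INR c) + RtoC (INR m) - 1) * negpow w m) c + - RtoC (INR c) ^ 2 * negpow w c
       = csum (fun m => (RtoC (INR c) + RtoC (INR m) - 1) * negpow w m) c - RtoC (INR c) ^ 2 * negpow w c). ring. }
    apply is_derive_C_plus.
    + apply is_derive_C_csum. intros m. apply is_derive_C_scal, is_derive_negpow.
    + apply is_derive_C_scal, is_derive_negpow.
  - ring.
Qed.

(** The difference of the two sides is holomorphic on Re s > -1 and vanishes on
    Re s > 1. *)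
Lemma zeta_c_continuation (zeta : C -> C) (c : nat) (zc : C -> C) (s : C) :
  is_riemann_zeta zeta -> (1 <= c)%nat -> is_zeta_c zeta c zc -> (-1 < Re s)%R ->
  RtoC (INR c) * zc s = boundary_terms c (negpow s) - regularized_sum c s.
Proof.
  intros Hz Hc Hzc Hs.
  set (h := fun w => RtoC (INR c) * zc w + (- (1) * boundary_terms c (negpow w) + regularized_sum c w)).
  assert (H : h s = 0).
  { apply (half_plane_unique_continuation h (-1) 1); [| | exact Hs].
    - intros w Hw. destruct (is_derive_regularized_sum c w Hc Hw) as [D [_ HD]].
      destruct (proj1 Hzc w) as [l Hl]. eexists. unfold h.
      apply is_derive_C_plus; [apply is_derive_C_scal, Hl |].
      apply is_derive_C_plus; [apply is_derive_C_scal, is_derive_boundary_terms | exact HD].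
    - intros w Hw. unfold h. rewrite (regularized_sum_eq_half_plane zeta c zc w Hz Hc Hzc Hw). ring. }
  apply Ceq_minus. rewrite <- H. unfold h. ring.
Qed.

Lemma C_derive_zeta_c (zeta : C -> C) (c : nat) (zc : C -> C) (s D : C) :
  is_riemann_zeta zeta -> (1 <= c)%nat -> is_zeta_c zeta c zc -> (-1 < Re s)%R ->
  Ccv (fun N => double_sum c (fun m => negpow s m * RtoC (ln (INR m))) (c * N)) D ->
  C_derive zc s = / RtoC (INR c) * (boundary_terms c (fun m => - (negpow s m * RtoC (ln (INR m)))) + D).
Proof.
  intros Hz Hc Hzc Hs HD.
  assert (Hc0 : RtoC (INR c) <> 0).
  { intros E. apply RtoC_inj in E. revert E. apply not_0_INR. lia. }
  apply is_C_derive_unique.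
  destruct (is_derive_regularized_sum c s Hc Hs) as [D' [HD' Hder]].
  rewrite (Ccv_unique _ _ _ HD HD').
  apply (is_derive_ext_loc (K := C_AbsRing) (V := C_NormedModule)
    (fun w => / RtoC (INR c) * (boundary_terms c (negpow w) + - (1) * regularized_sum c w))).
  - assert (Hr : (0 < Re s + 1)%R) by lra.
    exists (mkposreal _ Hr). intros w Hw. change (Cmod (w - s) < Re s + 1)%R in Hw.
    assert (Hw1 : (-1 < Re w)%R).
    { replace w with (s + (w - s)) by ring. rewrite re_plus.
      pose proof (re_le_Cmod (w - s)). pose proof (Rle_abs (- Re (w - s))). rewrite Rabs_Ropp in *. lra. }
    pose proof (zeta_c_continuation zeta c zc w Hz Hc Hzc Hw1) as E.
    change (/ RtoC (INR c) * (boundary_terms c (negpow w) + - (1) * regularized_sum c w) = zc w).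
    replace (boundary_terms c (negpow w) + - (1) * regularized_sum c w) with (RtoC (INR c) * zc w) by (rewrite E; ring).
    field. exact Hc0.
  - eapply is_derive_C_eq.
    + apply is_derive_C_scal. apply is_derive_C_plus; [apply is_derive_boundary_terms |].
      apply is_derive_C_scal. exact Hder.
    + ring.
Qed.

Lemma Cprod_Cexp (u f : nat -> C) (n : nat) :
  (forall i, (1 <= i <= n)%nat -> f i = Cexp (u i)) -> Cprod 1 n f = Cexp (csum u n).
Proof.
  unfold Cprod. induction n as [| n IH]; intros H.
  - symmetry. apply Cexp_0.
  - rewrite (Iter.iter_nat_Chasles Cmult 1 Cmult_1_l Cmult_assoc f 1 n (S n)) by lia.
    rewrite (Iter.iter_nat_point Cmult 1 Cmult_1_r), IH by (intros; apply H; lia).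
    simpl csum. rewrite Cexp_plus, H by lia. reflexivity.
Qed.

Lemma Cprod_2_Cexp (u f : nat -> C) (n : nat) : (1 <= n)%nat -> u 1%nat = 0 ->
  (forall i, (2 <= i <= n)%nat -> f i = Cexp (u i)) -> Cprod 2 n f = Cexp (csum u n).
Proof.
  intros Hn Hu H.
  rewrite <- (Cprod_Cexp u (fun i => Cexp (u i))) by reflexivity.
  unfold Cprod. rewrite (Iter.iter_nat_Chasles Cmult 1 Cmult_1_l Cmult_assoc _ 1 1 n) by lia.
  rewrite (Iter.iter_nat_point Cmult 1 Cmult_1_r), Hu, Cexp_0, Cmult_1_l.
  apply Iter.iter_nat_ext_loc. exact H.
Qed.

Lemma Ccv_Cexp (S : nat -> C) (l : C) : Ccv S l -> Ccv (fun n => Cexp (S n)) (Cexp l).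
Proof.
  intros H. apply Ccv_filterlim. apply Ccv_filterlim in H.
  eapply filterlim_comp; [exact H |]. eapply is_derive_continuous_C, is_derive_Cexp.
Qed.

(** By [C_derive_zeta_c] both sides are exponentials.  In the exponent the m = 1
    term vanishes because log 1 = 0, the terms 2 <= m < c give the first product,
    and for m = c the two contributions combine to
    -(2c - 1)/c + c = (c - 1)^2/c. *)
Theorem theorem9 :
  forall (zeta : C -> C), is_riemann_zeta zeta ->
  forall (c : nat), (2 <= c)%nat ->
  forall (zeta_c : C -> C), is_zeta_c zeta c zeta_c ->
  forall (s : C), (-1 < Re s)%R ->
  exists L : C,
    filterlim
      (fun N : nat =>
         Cprod 1 (c * N) (fun n : nat =>
           Cprod 1 c (fun i : nat =>
             npow (n + i)
               (a c n * a c i / (RtoC (INR c) * npow (n + i) s))%C)))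
      eventually (locally L) /\
    (Cexp (C_derive zeta_c s) =
      Cprod 2 (c - 1) (fun i : nat =>
        npow i (- ((RtoC (INR c) + RtoC (INR i) - 1)
                   / (RtoC (INR c) * npow i s))))
      * npow c ((RtoC (INR c) - 1) ^ 2 / npow c (s + 1))
      * L)%C.
Proof.
  intros zeta Hz c Hc2 zc Hzc s Hs.
  assert (Hc : (1 <= c)%nat) by lia.
  assert (Hc0 : RtoC (INR c) <> 0).
  { intros E. apply RtoC_inj in E. revert E. apply not_0_INR. lia. }
  destruct (is_derive_regularized_sum c s Hc Hs) as [D [HD _]].
  set (g := fun m => negpow s m * RtoC (ln (INR m))) in *.
  exists (Cexp (/ RtoC (INR c) * D)). split.
  - apply Ccv_filterlim.
    apply (Ccv_ext (fun N => Cexp (/ RtoC (INR c) * double_sum c g (c * N)))).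
    + intros N. unfold double_sum. rewrite <- csum_scal. symmetry. apply Cprod_Cexp. intros n _.
      rewrite <- csum_scal. apply Cprod_Cexp. intros i _.
      unfold g. rewrite negpow_npow. unfold npow at 1. f_equal.
      field. split; [apply npow_neq_0 | exact Hc0].
    + apply Ccv_Cexp, Ccv_scal. exact HD.
  - rewrite (C_derive_zeta_c zeta c zc s D Hz Hc Hzc Hs HD).
    set (u := fun i => - ((RtoC (INR c) + RtoC (INR i) - 1) / RtoC (INR c) * g i)).
    rewrite (Cprod_2_Cexp u).
    + unfold npow at 1. rewrite <- !Cexp_plus. f_equal.
      unfold boundary_terms.
      rewrite (csum_ext _ (fun i => RtoC (INR c) * u i)) by (intros i _; unfold u, g; field; exact Hc0).
      rewrite csum_scal.
      destruct c as [| c']; [lia |]. replace (S c' - 1)%nat with c' by lia.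
      change (csum u (S c')) with (csum u c' + u (S c')).
      replace (npow (S c') (s + 1)) with (npow (S c') s * RtoC (INR (S c'))).
      2: { rewrite <- (Cexp_ln_INR (S c')) by assumption. unfold npow. rewrite <- Cexp_plus. f_equal. ring. }
      unfold u, g. rewrite negpow_npow. field. split; [exact Hc0 | apply npow_neq_0].
    + lia.
    + unfold u, g. simpl (INR 1). rewrite ln_1. field. exact Hc0.
    + intros i _. unfold u, g. rewrite negpow_npow. unfold npow at 1. f_equal.
      field. split; [apply npow_neq_0 | exact Hc0].
Qed.
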